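(* Let $\rho,l,k_0,c_0,\delta,p,\lambda_0>0$, let $\theta_0>0$, $\theta_0>\theta_f$, and put $a=\sqrt{k_0/(\rho c_0)}$, $\mathrm{Ste}=c_0(\theta_0-\theta_f)/l$ and $A=\frac{2\lambda_0}{\rho c_0 a}$. Consider the non-classical one-phase Stefan problem for the unknowns $\theta=\theta(x,t)$ and $s=s(t)$: $$\rho c(\theta)\frac{\partial\theta}{\partial t}=\frac{\partial}{\partial x}\Big(k(\theta)\frac{\partial\theta}{\partial x}\Big)-\frac{\lambda_0}{\sqrt t}\,\frac{\partial\theta}{\partial x}(0,t),\quad 0<x<s(t),\ t>0,$$ $$\theta(0,t)=\theta_0,\qquad \theta(s(t),t)=\theta_f,\qquad k_0\frac{\partial\theta}{\partial x}(s(t),t)=-\rho l\,\dot s(t)\quad (t>0),\qquad s(0)=0,$$ where $$k(\theta)=k_0\Big(1+\delta\big(\tfrac{\theta-\theta_f}{\theta_0-\theta_f}\big)^p\Big),\qquad c(\theta)=c_0\Big(1+\delta\big(\tfrac{\theta-\theta_f}{\theta_0-\theta_f}\big)^p\Big).$$ Then this problem has a unique similarity type solution, given by $$\theta(x,t)=(\theta_0-\theta_f)\,y\Big(\frac{x}{2a\sqrt t}\Big)+\theta_f,\quad 0<x<s(t),\ t>0,\qquad s(t)=2a\lambda\sqrt t,\quad t>0,$$ where $(y,\lambda)$, with $\lambda>0$, $y\in C^\infty[0,\lambda]$ and $y\ge 0$, is the unique solution to the following functional problem: $\lambda$ is a solution of the equation $$\frac{\sqrt\pi\,x\exp(x^2)}{\mathrm{Ste}\big(A\int_0^x\exp(z^2)\,dz+1+\delta\big)}\Big(A\int_0^x\exp(z^2)\big(\mathrm{erf}(x)-\mathrm{erf}(z)\big)\,dz+(1+\delta)\,\mathrm{erf}(x)\Big)=1+\frac{\delta}{p+1},\quad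 x>0,$$ and, for all $0\le\eta\le\lambda$, $$y(\eta)\Big(1+\frac{\delta}{p+1}y^p(\eta)\Big)=1+\frac{\delta}{p+1}-\frac{\sqrt\pi\,\lambda\exp(\lambda^2)}{\mathrm{Ste}\big(A\int_0^\lambda\exp(z^2)\,dz+1+\delta\big)}\Big(A\int_0^\eta\exp(z^2)\big(\mathrm{erf}(\eta)-\mathrm{erf}(z)\big)\,dz+(1+\delta)\,\mathrm{erf}(\eta)\Big).$$
   Context: $\mathrm{erf}(x)=\frac{2}{\sqrt\pi}\int_0^x e^{-z^2}\,dz$. A similarity type solution is a solution $(\theta,s)$ of the Stefan problem of the form $s(t)=2a\lambda\sqrt t$, $\theta(x,t)=(\theta_0-\theta_f)\,y(x/(2a\sqrt t))+\theta_f$, with $\lambda>0$, $y\in C^\infty[0,\lambda]$ and $y\ge 0$.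
   Formalization: For non-integer p no solution y is C^∞ up to η=λ, so the class y∈C^∞[0,λ] is replaced by C^1[0,λ] with C^∞ on [0,λ); the solution y is also shown to be C^k[0,λ] for all k<p+1, and C^∞[0,λ] when p is an integer. *)

(* Defs.v *)
From Stdlib Require Import Reals.
From Coquelicot Require Import Coquelicot.
Open Scope R_scope.

Definition erf (x : R) : R :=
  2 / sqrt PI * RInt (fun z => exp (- (z ^ 2))) 0 x.

(** [z ^ p] for [z >= 0] and real [p > 0].  Stdlib's [Rpower 0 p] equals [1],
    because [ln 0 = 0] there; here [0 ^ p = 0].  The value at [z < 0] is
    never used. *)
Definition rpow (z p : R) : R :=
  if Rlt_dec 0 z then Rpower z p else 0.

Definition closed_itv (a b : R) : R -> Prop := fun x => a <= x <= b.
Definition clopen_itv (a b : R) : R -> Prop := fun x => a <= x < b.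

(** [k] times continuously differentiable on the set [D].  [D_in] and
    [continue_in] are relative to [D], so on an interval the derivatives at
    an endpoint belonging to it are one-sided, and values of [f] outside [D]
    are irrelevant. *)
Fixpoint Ck_on (k : nat) (D : R -> Prop) (f : R -> R) : Prop :=
  match k with
  | O => forall x, D x -> continue_in f D x
  | S j => exists f' : R -> R,
      (forall x, D x -> D_in f f' D x) /\ Ck_on j D f'
  end.

Definition Cinf_on (D : R -> Prop) (f : R -> R) : Prop :=
  forall k, Ck_on k D f.

(** Regularity of similarity profiles.  At the free boundary [y lam = 0] and
    [y' lam <> 0], while [z ^ p] is not smooth at [z = 0] unless [p] is an
    integer; so for other [p] no solution is C^infinity up to and including
    [lam].  Smoothness is asked on [[0, lam)], and at [lam] only what the
    Stefan condition needs. *)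
Definition profile_regular (lam : R) (y : R -> R) : Prop :=
  Ck_on 1 (closed_itv 0 lam) y /\ Cinf_on (clopen_itv 0 lam) y.

Definition admissible_profile (lam : R) (y : R -> R) : Prop :=
  0 < lam /\ profile_regular lam y /\ (forall eta, 0 <= eta <= lam -> 0 <= y eta).

Definition acoef (rho k0 c0 : R) : R := sqrt (k0 / (rho * c0)).

Definition Stefan_number (l c0 theta0 thetaf : R) : R :=
  c0 * (theta0 - thetaf) / l.

Definition Acoef (rho k0 c0 lambda0 : R) : R :=
  2 * lambda0 / (rho * c0 * acoef rho k0 c0).

(** [k(theta)] for [m0 = k0], and [c(theta)] for [m0 = c0]. *)
Definition thermal_coef (m0 delta p theta0 thetaf theta : R) : R :=
  m0 * (1 + delta * rpow ((theta - thetaf) / (theta0 - thetaf)) p).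

(** Classical solutions.  [theta x t] is meaningful for [0 <= x <= s t],
    [0 < t]; [thetax] is its space derivative there, one-sided at the two
    boundaries. *)
Definition Stefan_solution
    (rho l k0 c0 delta p lambda0 theta0 thetaf : R)
    (theta : R -> R -> R) (s : R -> R) : Prop :=
  s 0 = 0 /\
  (forall t, 0 < t -> 0 < s t) /\
  exists thetax : R -> R -> R,
    (forall x t, 0 < t -> 0 <= x <= s t ->
       D_in (fun u => theta u t) (fun u => thetax u t) (closed_itv 0 (s t)) x) /\
    (forall x t, 0 < t -> 0 < x < s t ->
       exists thetat fluxx : R,
         is_derive (fun tau => theta x tau) t thetat /\
         is_derive
           (fun u => thermal_coef k0 delta p theta0 thetaf (theta u t) * thetax u t)
           x fluxx /\
         rho * thermal_coef c0 delta p theta0 thetaf (theta x t) * thetat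
         = fluxx - lambda0 / sqrt t * thetax 0 t) /\
    (forall t, 0 < t -> theta 0 t = theta0) /\
    (forall t, 0 < t -> theta (s t) t = thetaf) /\
    (forall t, 0 < t ->
       exists sdot : R,
         is_derive s t sdot /\ k0 * thetax (s t) t = - (rho * l * sdot)).

Definition similarity_front (a lam t : R) : R := 2 * a * lam * sqrt t.

Definition similarity_temp (a theta0 thetaf : R) (y : R -> R) (x t : R) : R :=
  (theta0 - thetaf) * y (x / (2 * a * sqrt t)) + thetaf.

(** The form is imposed on the closed interval [0 <= x <= s t], so that the
    boundary data are data on [y]. *)
Definition similarity_solution
    (rho l k0 c0 delta p lambda0 theta0 thetaf : R)
    (theta : R -> R -> R) (s : R -> R) : Prop :=
  Stefan_solution rho l k0 c0 delta p lambda0 theta0 thetaf theta s /\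
  exists (lam : R) (y : R -> R),
    admissible_profile lam y /\
    (forall t, 0 < t -> s t = similarity_front (acoef rho k0 c0) lam t) /\
    (forall x t, 0 < t -> 0 <= x <= s t ->
       theta x t = similarity_temp (acoef rho k0 c0) theta0 thetaf y x t).

Definition Nfun (A delta x : R) : R :=
  A * RInt (fun z => exp (z ^ 2) * (erf x - erf z)) 0 x + (1 + delta) * erf x.

Definition Cfun (A Ste delta x : R) : R :=
  sqrt PI * x * exp (x ^ 2)
  / (Ste * (A * RInt (fun z => exp (z ^ 2)) 0 x + 1 + delta)).

Definition functional_problem (A Ste delta p lam : R) (y : R -> R) : Prop :=
  admissible_profile lam y /\
  Cfun A Ste delta lam * Nfun A delta lam = 1 + delta / (p + 1) /\
  (forall eta, 0 <= eta <= lam ->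
     y eta * (1 + delta / (p + 1) * rpow (y eta) p)
     = 1 + delta / (p + 1) - Cfun A Ste delta lam * Nfun A delta eta).

(* Main.v *)
Require Import Defs.
From Stdlib Require Import Reals.
From Coquelicot Require Import Coquelicot.
From Stdlib Require Import Lra Ranalysis5.
Open Scope R_scope.

(** The Kirchhoff transform [Y = y + delta / (p + 1) * y ^ (p + 1)] makes the
    similarity equation linear: [Y'' + 2 eta Y' = A y'(0)], with
    [Y' = (1 + delta y ^ p) y'].  The integrating factor [exp (eta ^ 2)] and a second
    integration give [Y] explicitly up to [y'(0)], which the Stefan condition at [lam]
    determines; the condition [y(lam) = 0] is then the equation for [lam].  Its left-hand
    side is strictly increasing and unbounded, because
    [x exp (x ^ 2) <= (1 + 2 x ^ 2) E(x)] and [E(x) <= E(1) + exp (x ^ 2)]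
    for [E(x)] the integral of [exp (z ^ 2)] over [[0, x]].  The transform is an
    increasing bijection, so [y] exists, is unique, and inherits its regularity from
    [y' = Y' / (1 + delta y ^ p)]. *)

(** * Real powers and the Kirchhoff transform *)

(** The source [lambda0 / sqrt t * theta_x(0, t)] scales like [1 / t], as the other two terms of the
    heat equation do, so in the variable [x / (2 a sqrt t)] time drops out and the source becomes
    the constant [A y'(0)], unknown in advance. The transform linearizes the equation because [k]
    and [c] carry the same factor [1 + delta y ^ p]: the time term is then a multiple of [eta Y'].
    The two directions meet different obstacles. For existence the transform is inverted on the
    whole line, so [y] has a two-sided derivative everywhere, the ends of [[0, lam]] included. For
    uniqueness a profile is given only on [[0, lam]], with one-sided derivatives at the ends and the
    equation only inside; it is extended by constants, and continuity does the work at the ends. At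
    [lam] the profile vanishes, and there [z ^ p] has limited smoothness for general [p]. Hence
    three forms of the bootstrap: orders below [p + 1] on any set, all orders where [y > 0], and all
    orders where [y >= 0] if [p] is a natural number. *)

Lemma is_derive_continuity_pt (f : R -> R) (x l : R) :
  is_derive f x l -> continuity_pt f x.
Proof.
  intros H; apply continuity_pt_filterlim.
  apply (ex_derive_continuous f x); exists l; exact H.
Qed.

Lemma ball_Rabs (x u : R) (e : posreal) : ball x e u -> Rabs (u - x) < e.
Proof. intros H; exact H. Qed.

Lemma rpow_pos_eq (z q : R) : 0 < z -> rpow z q = Rpower z q.
Proof. intros H; unfold rpow; destruct (Rlt_dec 0 z); [reflexivity | lra]. Qed.

Lemma rpow_nonpos_eq (z q : R) : z <= 0 -> rpow z q = 0.
Proof. intros H; unfold rpow; destruct (Rlt_dec 0 z); [lra | reflexivity]. Qed.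

Lemma rpow_ge0 (z q : R) : 0 <= rpow z q.
Proof.
  unfold rpow; destruct (Rlt_dec 0 z); [| lra].
  left; apply exp_pos.
Qed.

Lemma rpow_1_l (q : R) : rpow 1 q = 1.
Proof.
  rewrite rpow_pos_eq by lra.
  unfold Rpower; rewrite ln_1, Rmult_0_r; apply exp_0.
Qed.

Lemma rpow_S (z q : R) : z * rpow z q = rpow z (q + 1).
Proof.
  destruct (Rlt_le_dec 0 z) as [H | H].
  - rewrite !rpow_pos_eq, Rpower_plus, Rpower_1 by assumption; ring.
  - rewrite !rpow_nonpos_eq by assumption; ring.
Qed.

Lemma rpow_INR (z : R) (n : nat) : (0 < n)%nat -> 0 <= z -> rpow z (INR n) = z ^ n.
Proof.
  intros Hn [Hz | <-].
  - rewrite rpow_pos_eq by assumption; apply Rpower_pow; assumption.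
  - rewrite rpow_nonpos_eq, pow_i by (assumption || lra); reflexivity.
Qed.

Lemma is_derive_rpow_pos (z q : R) :
  0 < z -> is_derive (fun u => rpow u q) z (q * rpow z (q - 1)).
Proof.
  intros Hz.
  apply is_derive_ext_loc with (fun u => Rpower u q).
  - exists (mkposreal z Hz); intros u Hu.
    apply ball_Rabs in Hu; simpl in Hu.
    apply Rabs_def2 in Hu.
    rewrite rpow_pos_eq by lra; reflexivity.
  - rewrite rpow_pos_eq by assumption.
    apply is_derive_Reals, derivable_pt_lim_power; assumption.
Qed.

Lemma is_derive_rpow_neg (z q : R) :
  z < 0 -> is_derive (fun u => rpow u q) z 0.
Proof.
  intros Hz.
  apply is_derive_ext_loc with (fun _ => 0).
  - assert (Hz' : 0 < - z) by lra.
    exists (mkposreal (- z) Hz'); intros u Hu.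
    apply ball_Rabs in Hu; simpl in Hu.
    apply Rabs_def2 in Hu.
    rewrite rpow_nonpos_eq by lra; reflexivity.
  - apply @is_derive_const.
Qed.

Lemma rpow_small (q eps : R) :
  0 < q -> 0 < eps ->
  exists d : posreal, forall u, Rabs u < d -> rpow u q < eps.
Proof.
  intros Hq He.
  exists (mkposreal (Rpower eps (/ q)) (exp_pos _)); simpl; intros u Hu.
  apply Rabs_def2 in Hu.
  destruct (Rlt_le_dec 0 u) as [H | H].
  - rewrite rpow_pos_eq by assumption.
    replace eps with (Rpower (Rpower eps (/ q)) q).
    + apply Rlt_Rpower_l; lra.
    + rewrite Rpower_mult, Rinv_l, Rpower_1 by lra; reflexivity.
  - rewrite rpow_nonpos_eq; assumption.
Qed.

Lemma continuous_rpow (z q : R) : 0 < q -> continuous (fun u => rpow u q) z.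
Proof.
  intros Hq.
  destruct (Rtotal_order 0 z) as [H | [<- | H]].
  - apply @ex_derive_continuous; eexists; apply is_derive_rpow_pos; assumption.
  - apply continuity_pt_filterlim; intros eps He.
    destruct (rpow_small q eps Hq He) as [d Hd].
    exists d; split; [apply d |]; intros u [_ Hu].
    simpl in Hu |- *; unfold Rdist in *.
    rewrite Rminus_0_r in Hu.
    rewrite (rpow_nonpos_eq 0), Rminus_0_r, Rabs_pos_eq by (lra || apply rpow_ge0).
    apply Hd; assumption.
  - apply @ex_derive_continuous; eexists; apply is_derive_rpow_neg; assumption.
Qed.

Lemma is_derive_rpow (z q : R) :
  1 < q -> is_derive (fun u => rpow u q) z (q * rpow z (q - 1)).
Proof.
  intros Hq.
  destruct (Rtotal_order 0 z) as [H | [<- | H]].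
  - apply is_derive_rpow_pos; assumption.
  - rewrite rpow_nonpos_eq by lra; rewrite Rmult_0_r.
    apply is_derive_Reals; intros eps He.
    destruct (rpow_small (q - 1) eps) as [d Hd]; [lra | assumption |].
    exists d; intros h Hh Hhd.
    rewrite Rplus_0_l, (rpow_nonpos_eq 0) by lra.
    (* At 0 the difference quotient is [rpow h (q - 1)], which tends to 0 because [q > 1]. *)
    replace q with (q - 1 + 1) by ring; rewrite <- rpow_S.
    replace ((h * rpow h (q - 1) - 0) / h - 0) with (rpow h (q - 1)) by (field; assumption).
    rewrite Rabs_pos_eq by apply rpow_ge0.
    apply Hd; assumption.
  - rewrite rpow_nonpos_eq by lra; rewrite Rmult_0_r.
    apply is_derive_rpow_neg; assumption.
Qed.

(* As [rpow] vanishes on [z <= 0], this is the identity there, so it is a C^1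
   increasing bijection of the whole line. *)
Definition kirchhoff (delta p z : R) : R := z * (1 + delta / (p + 1) * rpow z p).

Lemma kirchhoff_0 (delta p : R) : kirchhoff delta p 0 = 0.
Proof. unfold kirchhoff; ring. Qed.

Lemma kirchhoff_1 (delta p : R) : kirchhoff delta p 1 = 1 + delta / (p + 1).
Proof. unfold kirchhoff; rewrite rpow_1_l; ring. Qed.

(** Absorbing the factor [z] raises the exponent to [p + 1 > 1], so the derivative exists at 0 even
    when [p < 1]. *)
Lemma is_derive_kirchhoff (delta p z : R) :
  0 < p -> is_derive (kirchhoff delta p) z (1 + delta * rpow z p).
Proof.
  intros Hp.
  apply is_derive_ext with (fun u => u + delta / (p + 1) * rpow u (p + 1)).
  - intros u; unfold kirchhoff; rewrite <- rpow_S.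
    change (u + delta / (p + 1) * (u * rpow u p) = u * (1 + delta / (p + 1) * rpow u p)); ring.
  - replace (1 + delta * rpow z p)
      with (1 + delta / (p + 1) * ((p + 1) * rpow z (p + 1 - 1)))
      by (replace (p + 1 - 1) with p by ring; field; lra).
    apply @is_derive_plus; [apply @is_derive_id |].
    apply is_derive_scal, is_derive_rpow; lra.
Qed.

(** The derivative is at least 1. This one bound yields injectivity, the range needed for
    surjectivity, and a 1-Lipschitz inverse. *)
Lemma kirchhoff_expand (delta p u v : R) :
  0 < delta -> 0 < p -> u <= v -> v - u <= kirchhoff delta p v - kirchhoff delta p u.
Proof.
  intros Hd Hp Huv.
  destruct (MVT_gen (kirchhoff delta p) u v (fun z => 1 + delta * rpow z p)) as [c [_ Hc]].
  - intros z _; apply is_derive_kirchhoff; assumption.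
  - intros z _; eapply is_derive_continuity_pt,  is_derive_kirchhoff; assumption.
  - rewrite Hc.
    pose proof (Rmult_le_pos _ _ (Rlt_le _ _ Hd) (rpow_ge0 c p)).
    rewrite <- (Rmult_1_l (v - u)) at 1.
    apply Rmult_le_compat_r; lra.
Qed.

Lemma kirchhoff_inj (delta p u v : R) :
  0 < delta -> 0 < p -> kirchhoff delta p u = kirchhoff delta p v -> u = v.
Proof.
  intros Hd Hp H.
  destruct (Rle_lt_dec u v) as [L | L].
  - pose proof (kirchhoff_expand delta p u v Hd Hp L); lra.
  - pose proof (kirchhoff_expand delta p v u Hd Hp (Rlt_le _ _ L)); lra.
Qed.

Lemma kirchhoff_surj (delta p v : R) :
  0 < delta -> 0 < p -> {z : R | kirchhoff delta p z = v}.
Proof.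
  intros Hd Hp.
  (* By expansion away from 0, the values at [- b] and [b] are at most [- b] and at least [b], so
     they enclose [v] strictly. *)
  set (b := Rabs v + 1).
  assert (Hb : 0 < b) by (unfold b; pose proof (Rabs_pos v); lra).
  destruct (IVT (fun z => kirchhoff delta p z - v) (- b) b) as [z [_ Hz]].
  - intros z; eapply is_derive_continuity_pt.
    exact (is_derive_minus _ _ z _ _ (is_derive_kirchhoff delta p z Hp) (is_derive_const v z)).
  - lra.
  - pose proof (kirchhoff_expand delta p (- b) 0 Hd Hp ltac:(lra)).
    rewrite kirchhoff_0 in H.
    pose proof (Rle_abs (- v)); rewrite Rabs_Ropp in *; unfold b in *; lra.
  - pose proof (kirchhoff_expand delta p 0 b Hd Hp ltac:(lra)).
    rewrite kirchhoff_0 in H.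
    pose proof (Rle_abs v); unfold b in *; lra.
  - exists z; lra.
Qed.

(** [g] is any right inverse, with no regularity assumed. The expansion bound makes it nondecreasing
    and 1-Lipschitz, hence continuous, and then the derivative rule for inverse functions
    applies. *)
Lemma is_derive_kirchhoff_inv (delta p : R) (g : R -> R) (v : R) :
  0 < delta -> 0 < p -> (forall w, kirchhoff delta p (g w) = w) ->
  is_derive g v (/ (1 + delta * rpow (g v) p)).
Proof.
  intros Hd Hp Hg.
  assert (Hlip : forall u w, u <= w -> 0 <= g w - g u <= w - u).
  { intros u w Huw.
    destruct (Rle_lt_dec (g u) (g w)) as [L | L].
    - pose proof (kirchhoff_expand delta p _ _ Hd Hp L); rewrite !Hg in H; lra.
    - pose proof (kirchhoff_expand delta p _ _ Hd Hp (Rlt_le _ _ L)); rewrite !Hg in H; lra. }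
  assert (Prf : forall a, g (v - 1) <= a <= g (v + 1) -> derivable_pt (kirchhoff delta p) a).
  { intros a _; exists (1 + delta * rpow a p).
    apply is_derive_Reals, is_derive_kirchhoff; assumption. }
  assert (Hcont : continuity_pt g v).
  { intros eps He; exists eps; split; [assumption |].
    intros u [_ Hu]; simpl in Hu |- *; unfold Rdist in *.
    apply Rle_lt_trans with (2 := Hu).
    destruct (Rle_lt_dec v u) as [L | L].
    - pose proof (Hlip v u L); rewrite !Rabs_pos_eq by lra; lra.
    - pose proof (Hlip u v (Rlt_le _ _ L)).
      rewrite (Rabs_minus_sym (g u)), (Rabs_minus_sym u), !Rabs_pos_eq by lra; lra. }
  assert (Hin : g (v - 1) <= g v <= g (v + 1)).
  { pose proof (Hlip (v - 1) v ltac:(lra)); pose proof (Hlip v (v + 1) ltac:(lra)); lra. }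
  assert (Hpos : 0 < 1 + delta * rpow (g v) p).
  { pose proof (Rmult_le_pos _ _ (Rlt_le _ _ Hd) (rpow_ge0 (g v) p)); lra. }
  assert (Hval : derive_pt (kirchhoff delta p) (g v) (Prf (g v) Hin) = 1 + delta * rpow (g v) p).
  { apply derive_pt_eq_0, is_derive_Reals, is_derive_kirchhoff; assumption. }
  apply is_derive_Reals.
  rewrite <- Hval, <- Rdiv_1_l.
  apply (derivable_pt_lim_recip_interv (kirchhoff delta p) g (v - 1) (v + 1) v Prf Hcont);
    try lra.
  intros w _; unfold comp, id; apply Hg.
Qed.

(** * The equation for the free boundary *)

Lemma is_derive_nonneg_le (f df : R -> R) (a b : R) :
  (forall x, a <= x <= b -> is_derive f x (df x)) ->
  (forall x, a <= x <= b -> 0 <= df x) -> a <= b -> f a <= f b.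
Proof.
  intros Hd Hpos Hab.
  destruct (MVT_gen f a b df) as [c [Hc Heq]].
  - intros x Hx; rewrite Rmin_left, Rmax_right in Hx by lra; apply Hd; lra.
  - intros x Hx; rewrite Rmin_left, Rmax_right in Hx by lra.
    eapply is_derive_continuity_pt, Hd; lra.
  - rewrite Rmin_left, Rmax_right in Hc by lra.
    pose proof (Rmult_le_pos _ (b - a) (Hpos c Hc) ltac:(lra)); lra.
Qed.

Lemma is_derive_pos_lt (f df : R -> R) (a b : R) :
  (forall x, a <= x <= b -> is_derive f x (df x)) ->
  (forall x, a <= x <= b -> 0 < df x) -> a < b -> f a < f b.
Proof.
  intros Hd Hpos Hab.
  destruct (MVT_gen f a b df) as [c [Hc Heq]].
  - intros x Hx; rewrite Rmin_left, Rmax_right in Hx by lra; apply Hd; lra.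
  - intros x Hx; rewrite Rmin_left, Rmax_right in Hx by lra.
    eapply is_derive_continuity_pt, Hd; lra.
  - rewrite Rmin_left, Rmax_right in Hc by lra.
    pose proof (Rmult_lt_0_compat _ (b - a) (Hpos c Hc) ltac:(lra)); lra.
Qed.

(** The similarity equation holds only inside the interval, so continuity replaces differentiability
    at the ends. It is asked on the whole line because the lemma is applied to clamped
    extensions. *)
Lemma is_derive_zero_eq (f : R -> R) (a b : R) :
  (forall x, a < x < b -> is_derive f x 0) ->
  (forall x, continuity_pt f x) ->
  forall x, a <= x <= b -> f x = f a.
Proof.
  intros Hd Hc x Hx.
  destruct (MVT_gen f a x (fun _ => 0)) as [c [_ Heq]].
  - intros u Hu; rewrite Rmin_left, Rmax_right in Hu by lra; apply Hd; lra.
  - intros u _; apply Hc.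
  - lra.
Qed.

Lemma is_derive_RInt_continuous (f : R -> R) (a x : R) :
  (forall z, continuous f z) -> is_derive (fun u => RInt f a u) x (f x).
Proof.
  intros Hf; apply (is_derive_RInt f (fun u => RInt f a u) a); [| apply Hf].
  apply filter_forall; intros u; apply @RInt_correct, @ex_RInt_continuous.
  intros z _; apply Hf.
Qed.

(** This is [sqrt PI / 2] times the imaginary error function. *)
Definition expint (x : R) : R := RInt (fun z => exp (z ^ 2)) 0 x.

Lemma is_derive_exp_sqr (x : R) :
  is_derive (fun z => exp (z ^ 2)) x (2 * x * exp (x ^ 2)).
Proof. auto_derive; [exact I | simpl; ring]. Qed.

Lemma is_derive_expint (x : R) : is_derive expint x (exp (x ^ 2)).
Proof.
  apply (is_derive_RInt_continuous (fun z => exp (z ^ 2))).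
  intros z; apply (ex_derive_continuous (fun z => exp (z ^ 2))).
  eexists; apply is_derive_exp_sqr.
Qed.

Lemma Derive_expint (x : R) : Derive (fun u => expint u) x = exp (x ^ 2).
Proof. apply is_derive_unique, is_derive_expint. Qed.

Lemma expint_0 : expint 0 = 0.
Proof. apply (RInt_point 0 (fun z => exp (z ^ 2))). Qed.

Lemma expint_ge0 (x : R) : 0 <= x -> 0 <= expint x.
Proof.
  intros Hx; rewrite <- expint_0 at 1.
  apply (is_derive_nonneg_le _ (fun z => exp (z ^ 2))); [| | assumption].
  - intros; apply is_derive_expint.
  - intros; left; apply exp_pos.
Qed.

(** The difference of the two sides vanishes at 0 and has derivative [4 z * expint z]. The factor
    [1 + 2 x ^ 2] is the one that appears when [x * exp (x ^ 2)] is differentiated in [Cfun]. *)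
Lemma expint_lower (x : R) :
  0 <= x -> x * exp (x ^ 2) <= (1 + 2 * x ^ 2) * expint x.
Proof.
  intros Hx.
  enough ((1 + 2 * 0 ^ 2) * expint 0 - 0 * exp (0 ^ 2)
          <= (1 + 2 * x ^ 2) * expint x - x * exp (x ^ 2))
    by (rewrite expint_0 in *; lra).
  apply (is_derive_nonneg_le
           (fun z => (1 + 2 * z ^ 2) * expint z - z * exp (z ^ 2))
           (fun z => 4 * z * expint z)); [| | assumption].
  - intros z _; auto_derive.
    + eexists; apply is_derive_expint.
    + rewrite Derive_expint; simpl; ring.
  - intros z Hz.
    pose proof (Rmult_le_pos _ _ (proj1 Hz) (expint_ge0 z (proj1 Hz))); lra.
Qed.

(** Once [2 z >= 1], [exp (z ^ 2)] grows at least as fast as its integral. The bound keeps the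
    denominator of [Cfun] within a constant multiple of [exp (x ^ 2)]. *)
Lemma expint_upper (x : R) : 1 <= x -> expint x <= expint 1 + exp (x ^ 2).
Proof.
  intros Hx.
  enough (exp (1 ^ 2) - expint 1 <= exp (x ^ 2) - expint x)
    by (pose proof (exp_pos (1 ^ 2)); lra).
  apply (is_derive_nonneg_le (fun z => exp (z ^ 2) - expint z)
           (fun z => (2 * z - 1) * exp (z ^ 2))); [| | assumption].
  - intros z _; auto_derive.
    + eexists; apply is_derive_expint.
    + rewrite Derive_expint; simpl; ring.
  - intros z Hz; apply Rmult_le_pos; [lra | left; apply exp_pos].
Qed.

Lemma is_derive_erf (x : R) : is_derive erf x (2 / sqrt PI * exp (- (x ^ 2))).
Proof.
  apply is_derive_scal.
  apply (is_derive_RInt_continuous (fun z => exp (- (z ^ 2)))).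
  intros z; apply (ex_derive_continuous (fun z => exp (- (z ^ 2)))).
  auto_derive; exact I.
Qed.

Lemma Derive_erf (x : R) : Derive (fun u => erf u) x = 2 / sqrt PI * exp (- (x ^ 2)).
Proof. apply is_derive_unique, is_derive_erf. Qed.

Lemma erf_0 : erf 0 = 0.
Proof.
  unfold erf; rewrite (RInt_point 0 (fun z => exp (- (z ^ 2)))).
  apply Rmult_0_r.
Qed.

(** The upper limit also occurs in the integrand of [Nfun]; pulling [erf x] out leaves integrals to
    which the fundamental theorem of calculus applies. *)
Lemma Nfun_alt (A delta x : R) :
  Nfun A delta x
  = A * (erf x * expint x - RInt (fun z => exp (z ^ 2) * erf z) 0 x)
    + (1 + delta) * erf x.
Proof.
  unfold Nfun; f_equal; f_equal.
  apply is_RInt_unique.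
  apply is_RInt_ext with (fun z => minus (scal (erf x) (exp (z ^ 2))) (exp (z ^ 2) * erf z)).
  - intros z _; unfold minus, plus, opp, scal; simpl; unfold mult; simpl; ring.
  - apply @is_RInt_minus; [apply @is_RInt_scal |];
      apply @RInt_correct, @ex_RInt_continuous; intros z _.
    + apply (ex_derive_continuous (fun z => exp (z ^ 2))).
      eexists; apply is_derive_exp_sqr.
    + apply (ex_derive_continuous (fun z => exp (z ^ 2) * erf z)).
      auto_derive; eexists; apply is_derive_erf.
Qed.

(** In the split form the two terms [A * erf x * exp (x ^ 2)] cancel, and only those with the
    derivative of [erf] survive. Hence [N'' + 2 x N'] is the constant [2 A / sqrt PI]: up to a
    factor, [N'] solves the linear equation for [Y']. *)
Lemma is_derive_Nfun (A delta x : R) :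
  is_derive (Nfun A delta) x
    (2 / sqrt PI * exp (- (x ^ 2)) * (A * expint x + 1 + delta)).
Proof.
  apply is_derive_ext with (fun x =>
    A * (erf x * expint x - RInt (fun z => exp (z ^ 2) * erf z) 0 x)
    + (1 + delta) * erf x); [intros u; symmetry; apply Nfun_alt |].
  assert (HI : is_derive (fun u => RInt (fun z => exp (z ^ 2) * erf z) 0 u) x
                 (exp (x ^ 2) * erf x)).
  { apply (is_derive_RInt_continuous (fun z => exp (z ^ 2) * erf z)).
    intros z; apply (ex_derive_continuous (fun z => exp (z ^ 2) * erf z)).
    auto_derive; eexists; apply is_derive_erf. }
  set (I := fun u => RInt (fun z => exp (z ^ 2) * erf z) 0 u) in *.
  assert (HI' : Derive (fun u => I u) x = exp (x ^ 2) * erf x) by (apply is_derive_unique, HI).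
  apply is_derive_ext with (fun x =>
    A * (erf x * expint x - I x) + (1 + delta) * erf x); [reflexivity |].
  auto_derive.
  - pose proof (is_derive_erf x) as He.
    refine (conj _ (conj _ (conj _ (conj _ Logic.I)))); eexists;
      [exact He | apply is_derive_expint | exact HI | exact He].
  - rewrite HI', Derive_expint, Derive_erf.
    ring.
Qed.

Lemma Nfun_0 (A delta : R) : Nfun A delta 0 = 0.
Proof.
  rewrite Nfun_alt, erf_0, expint_0, (RInt_point 0 (fun z => exp (z ^ 2) * erf z)).
  unfold zero; simpl; ring.
Qed.

Lemma sqrt_PI_pos : 0 < sqrt PI.
Proof. apply sqrt_lt_R0, PI_RGT_0. Qed.

Lemma denom_pos (A delta x : R) :
  0 < A -> 0 < delta -> 0 <= x -> 0 < A * expint x + 1 + delta.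
Proof.
  intros HA Hd Hx.
  pose proof (Rmult_le_pos _ _ (Rlt_le _ _ HA) (expint_ge0 x Hx)); lra.
Qed.

Lemma Nfun_derivative_pos (A delta x : R) :
  0 < A -> 0 < delta -> 0 <= x ->
  0 < 2 / sqrt PI * exp (- (x ^ 2)) * (A * expint x + 1 + delta).
Proof.
  intros HA Hd Hx.
  pose proof sqrt_PI_pos.
  apply Rmult_lt_0_compat; [| apply denom_pos; assumption].
  apply Rmult_lt_0_compat; [apply Rdiv_lt_0_compat; lra | apply exp_pos].
Qed.

Lemma Nfun_incr (A delta x y : R) :
  0 < A -> 0 < delta -> 0 <= x -> x < y -> Nfun A delta x < Nfun A delta y.
Proof.
  intros HA Hd Hx Hxy.
  eapply is_derive_pos_lt; [| | exact Hxy].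
  - intros z _; apply is_derive_Nfun.
  - intros z Hz; apply Nfun_derivative_pos; lra.
Qed.

Lemma is_derive_Cfun (A Ste delta x : R) :
  0 < A -> 0 < Ste -> 0 < delta -> 0 <= x ->
  is_derive (Cfun A Ste delta) x
    (sqrt PI * exp (x ^ 2) / Ste
     * (((1 + 2 * x ^ 2) * (A * expint x + 1 + delta) - A * (x * exp (x ^ 2)))
        / (A * expint x + 1 + delta) ^ 2)).
Proof.
  intros HA HS Hd Hx.
  pose proof (denom_pos A delta x HA Hd Hx) as HD.
  apply is_derive_ext with (fun x =>
    sqrt PI * x * exp (x ^ 2) / (Ste * (A * expint x + 1 + delta))); [reflexivity |].
  auto_derive.
  - split; [eexists; apply is_derive_expint |].
    split; [| exact I]; apply Rgt_not_eq, Rmult_lt_0_compat; assumption.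
  - rewrite Derive_expint.
    replace (x * (x * 1)) with (x ^ 2) by ring.
    field; lra.
Qed.

Lemma Cfun_incr (A Ste delta x y : R) :
  0 < A -> 0 < Ste -> 0 < delta -> 0 <= x -> x <= y ->
  Cfun A Ste delta x <= Cfun A Ste delta y.
Proof.
  intros HA HS Hd Hx Hxy.
  eapply is_derive_nonneg_le; [| | exact Hxy].
  - intros z Hz; apply is_derive_Cfun; lra || assumption.
  - intros z Hz; cbv beta.
    assert (Hz0 : 0 <= z) by lra.
    pose proof (denom_pos A delta z HA Hd Hz0) as HD.
    pose proof sqrt_PI_pos; pose proof (exp_pos (z ^ 2)).
    pose proof (expint_lower z Hz0) as HE.
    (* Scaled by [A], the bound absorbs the negative term [A * (z * exp (z ^ 2))]; what remains is
       [(1 + 2 z ^ 2) * (1 + delta)]. *)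
    apply Rmult_le_compat_l with (r := A) in HE; [| lra].
    apply Rmult_le_pos.
    + left; apply Rdiv_lt_0_compat; [apply Rmult_lt_0_compat |]; assumption.
    + apply Rdiv_le_0_compat; [| apply pow_lt; assumption].
      pose proof (Rmult_le_pos (1 + 2 * z ^ 2) (1 + delta)
                    ltac:(pose proof (pow2_ge_0 z); lra) ltac:(lra)).
      lra.
Qed.

Lemma Cfun_pos (A Ste delta x : R) :
  0 < A -> 0 < Ste -> 0 < delta -> 0 < x -> 0 < Cfun A Ste delta x.
Proof.
  intros HA HS Hd Hx.
  apply Rdiv_lt_0_compat.
  - apply Rmult_lt_0_compat; [| apply exp_pos].
    apply Rmult_lt_0_compat; [apply sqrt_PI_pos | assumption].
  - apply Rmult_lt_0_compat; [assumption |].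
    apply (denom_pos A delta x); lra.
Qed.

(** Strictness comes from [Nfun]; [Cfun] contributes positivity and weak monotonicity. *)
Lemma front_equation_incr (A Ste delta x y : R) :
  0 < A -> 0 < Ste -> 0 < delta -> 0 < x -> x < y ->
  Cfun A Ste delta x * Nfun A delta x < Cfun A Ste delta y * Nfun A delta y.
Proof.
  intros HA HS Hd Hx Hxy.
  pose proof (Cfun_pos A Ste delta y HA HS Hd ltac:(lra)).
  pose proof (Nfun_incr A delta 0 x HA Hd ltac:(lra) Hx) as HN; rewrite Nfun_0 in HN.
  apply Rle_lt_trans with (Cfun A Ste delta y * Nfun A delta x).
  - apply Rmult_le_compat_r; [lra |]; apply Cfun_incr; lra.
  - apply Rmult_lt_compat_l; [assumption |]; apply Nfun_incr; lra.
Qed.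

Lemma front_equation_inj (A Ste delta x y : R) :
  0 < A -> 0 < Ste -> 0 < delta -> 0 < x -> 0 < y ->
  Cfun A Ste delta x * Nfun A delta x = Cfun A Ste delta y * Nfun A delta y -> x = y.
Proof.
  intros HA HS Hd Hx Hy H.
  destruct (Rtotal_order x y) as [L | [L | L]]; [| assumption |].
  - pose proof (front_equation_incr A Ste delta x y HA HS Hd Hx L); lra.
  - pose proof (front_equation_incr A Ste delta y x HA HS Hd Hy L); lra.
Qed.

(** For [x >= 1] the denominator is at most [Ste * B * exp (x ^ 2)], since [exp (x ^ 2) >= 1]
    absorbs the constants. The exponentials cancel and the factor [x] remains. *)
Lemma Cfun_linear_lower (A Ste delta : R) :
  0 < A -> 0 < Ste -> 0 < delta ->
  exists c, 0 < c /\ forall x, 1 <= x -> c * x <= Cfun A Ste delta x.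
Proof.
  intros HA HS Hd.
  pose proof (expint_ge0 1 ltac:(lra)) as H1.
  pose proof (Rmult_le_pos _ _ (Rlt_le _ _ HA) H1) as HA1.
  set (B := A * expint 1 + A + 1 + delta).
  assert (HB : 0 < B) by (unfold B; lra).
  pose proof sqrt_PI_pos as Hpi.
  exists (sqrt PI / (Ste * B)); split.
  - apply Rdiv_lt_0_compat; [| apply Rmult_lt_0_compat]; assumption.
  - intros x Hx.
    assert (HD : 0 < A * expint x + 1 + delta) by (apply denom_pos; lra).
    change (Cfun A Ste delta x)
      with (sqrt PI * x * exp (x ^ 2) / (Ste * (A * expint x + 1 + delta))).
    assert (He : 1 <= exp (x ^ 2)).
    { pose proof (pow2_ge_0 x); pose proof (exp_ineq1_le (x ^ 2)); lra. }
    assert (HDB : A * expint x + 1 + delta <= B * exp (x ^ 2)).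
    { pose proof (Rmult_le_compat_l A _ _ (Rlt_le _ _ HA) (expint_upper x Hx)).
      pose proof (Rmult_le_compat_l (A * expint 1 + 1 + delta) _ _ ltac:(lra) He).
      unfold B; lra. }
    (* This positive factor clears both fractions and turns the goal into [HDB]. *)
    apply Rmult_le_reg_r with (Ste * (A * expint x + 1 + delta) * (B / (sqrt PI * x))).
    + repeat apply Rmult_lt_0_compat; try assumption.
      apply Rinv_0_lt_compat, Rmult_lt_0_compat; lra.
    + replace (sqrt PI / (Ste * B) * x
                 * (Ste * (A * expint x + 1 + delta) * (B / (sqrt PI * x))))
        with (A * expint x + 1 + delta) by (field; lra).
      replace (sqrt PI * x * exp (x ^ 2) / (Ste * (A * expint x + 1 + delta))
                 * (Ste * (A * expint x + 1 + delta) * (B / (sqrt PI * x))))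
        with (B * exp (x ^ 2)) by (field; lra).
      assumption.
Qed.

Lemma front_equation_solvable (A Ste delta K : R) :
  0 < A -> 0 < Ste -> 0 < delta -> 0 < K ->
  exists lam, 0 < lam /\ Cfun A Ste delta lam * Nfun A delta lam = K.
Proof.
  intros HA HS Hd HK.
  destruct (Cfun_linear_lower A Ste delta HA HS Hd) as [c [Hc Hlow]].
  pose proof (Nfun_incr A delta 0 1 HA Hd ltac:(lra) ltac:(lra)) as HN.
  rewrite Nfun_0 in HN.
  set (n := Nfun A delta 1) in *.
  (* With [Cfun M >= c * M] and [Nfun M >= n], the product at [M] is at least
     [c * M * n = c * n + K], which exceeds [K]. *)
  set (M := 1 + K / (c * n)).
  assert (HM : 1 < M).
  { unfold M; assert (0 < K / (c * n)); [| lra].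
    apply Rdiv_lt_0_compat; [| apply Rmult_lt_0_compat]; assumption. }
  destruct (IVT_interv (fun x => Cfun A Ste delta x * Nfun A delta x - K) 0 M)
    as [lam [Hlam Heq]].
  - intros x Hx; eapply (is_derive_continuity_pt
      (fun x => Cfun A Ste delta x * Nfun A delta x - K)).
    apply (is_derive_minus (fun x => Cfun A Ste delta x * Nfun A delta x) (fun _ => K)).
    + apply (is_derive_mult (Cfun A Ste delta) (Nfun A delta));
        [apply is_derive_Cfun; lra | apply is_derive_Nfun | intros; apply Rmult_comm].
    + apply @is_derive_const.
  - lra.
  - rewrite Nfun_0; lra.
  - pose proof (Hlow M ltac:(lra)) as HC.
    pose proof (Nfun_incr A delta 1 M HA Hd ltac:(lra) HM) as HNM; fold n in HNM.
    assert (H1 : c * M * n = c * n + K) by (unfold M; field; lra).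
    assert (H2 : c * M * n <= Cfun A Ste delta M * Nfun A delta M).
    { apply Rmult_le_compat; try lra; apply Rmult_le_pos; lra. }
    pose proof (Rmult_lt_0_compat _ _ Hc HN); lra.
  - exists lam; split; [| lra].
    destruct (proj1 Hlam) as [L | <-]; [assumption |].
    rewrite Nfun_0 in Heq; lra.
Qed.

(** * Smoothness on a set *)

Lemma D_in_ext_on (f g d e : R -> R) (D : R -> Prop) (x : R) :
  (forall u, D u -> f u = g u) -> D x -> d x = e x -> D_in f d D x -> D_in g e D x.
Proof.
  intros Hfg Hx Hde H eps He.
  destruct (H eps He) as [alp [Ha Hl]]; exists alp; split; [assumption |].
  intros u Hu; rewrite <- Hde, <- !Hfg by (assumption || apply Hu).
  apply Hl; assumption.
Qed.

Lemma is_derive_D_in (f d : R -> R) (D : R -> Prop) (x : R) :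
  is_derive f x (d x) -> D_in f d D x.
Proof.
  intros H; apply D_in_imp with no_cond; [intros; exact Logic.I |].
  apply derivable_pt_lim_D_in, is_derive_Reals, H.
Qed.

Lemma D_in_comp (f f1 g g1 : R -> R) (D : R -> Prop) (x : R) :
  D_in f f1 D x -> is_derive g (f x) (g1 (f x)) ->
  D_in (fun u => g (f u)) (fun u => g1 (f u) * f1 u) D x.
Proof.
  intros Hf Hg.
  apply (is_derive_D_in _ _ no_cond) in Hg.
  pose proof (Dcomp _ _ _ _ _ _ _ Hf Hg) as H.
  intros eps He; destruct (H eps He) as [alp [Ha Hl]].
  exists alp; split; [assumption |].
  intros u [[Hu Hne] Hd]; rewrite Rmult_comm; apply Hl.
  split; [split; [split; [assumption | exact Logic.I] | assumption] | assumption].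
Qed.

Lemma continue_in_comp (f g : R -> R) (D : R -> Prop) (x : R) :
  continue_in f D x -> continuous g (f x) -> continue_in (fun u => g (f u)) D x.
Proof.
  intros Hf Hg eps He.
  apply continuity_pt_filterlim in Hg.
  destruct (Hg eps He) as [b [Hb Hgb]].
  destruct (Hf b Hb) as [alp [Ha Hl]].
  exists alp; split; [assumption |].
  intros u Hu.
  (* Limits here are punctured: [u] differs from [x], yet [f u] may equal [f x]. *)
  destruct (Req_dec (f x) (f u)) as [<- | Hne].
  - simpl; unfold Rdist; rewrite Rminus_diag, Rabs_R0; assumption.
  - apply Hgb; split; [split; [exact Logic.I | assumption] | apply Hl; assumption].
Qed.

Lemma Ck_on_ext (k : nat) (D : R -> Prop) (f g : R -> R) :
  (forall x, D x -> f x = g x) -> Ck_on k D f -> Ck_on k D g.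
Proof.
  destruct k as [| k]; simpl; intros Hfg.
  - intros H x Hx eps He; destruct (H x Hx eps He) as [alp [Ha Hl]].
    exists alp; split; [assumption |].
    intros u Hu; rewrite <- !Hfg by (assumption || apply Hu).
    apply Hl; assumption.
  - intros [f' [Hf' Hk]]; exists f'; split; [| assumption].
    intros x Hx; apply D_in_ext_on with f f'; auto.
Qed.

Lemma Ck_on_pred (k : nat) (D : R -> Prop) (f : R -> R) : Ck_on (S k) D f -> Ck_on k D f.
Proof.
  revert f; induction k as [| k IH]; intros f [f' [Hf' Hk]].
  - intros x Hx; apply cont_deriv with f'; auto.
  - exists f'; split; auto.
Qed.

Lemma Ck_on_const (k : nat) (D : R -> Prop) (c : R) : Ck_on k D (fun _ => c).
Proof.
  revert c; induction k as [| k IH]; intros c.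
  - intros x Hx; apply cont_deriv with (fun _ => 0); apply is_derive_D_in, @is_derive_const.
  - exists (fun _ => 0); split; [| apply IH].
    intros x _; apply is_derive_D_in, @is_derive_const.
Qed.

Lemma Ck_on_id (k : nat) (D : R -> Prop) : Ck_on k D (fun x => x).
Proof.
  assert (H : forall x, D_in (fun x => x) (fun _ => 1) D x)
    by (intros x; apply is_derive_D_in, @is_derive_id).
  destruct k as [| k].
  - intros x _; apply cont_deriv with (fun _ => 1), H.
  - exists (fun _ => 1); split; [auto | apply Ck_on_const].
Qed.

Lemma Ck_on_plus (k : nat) (D : R -> Prop) (f g : R -> R) :
  Ck_on k D f -> Ck_on k D g -> Ck_on k D (fun x => f x + g x).
Proof.
  revert f g; induction k as [| k IH]; intros f g.
  - intros Hf Hg x Hx; apply limit_plus; [apply Hf | apply Hg]; assumption.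
  - intros [f' [Hf Hf']] [g' [Hg Hg']].
    exists (fun x => f' x + g' x); split; [| auto].
    intros x Hx; apply Dadd; auto.
Qed.

Lemma Ck_on_mult (k : nat) (D : R -> Prop) (f g : R -> R) :
  Ck_on k D f -> Ck_on k D g -> Ck_on k D (fun x => f x * g x).
Proof.
  revert f g; induction k as [| k IH]; intros f g.
  - intros Hf Hg x Hx; apply limit_mul; [apply Hf | apply Hg]; assumption.
  - intros Hf0 Hg0.
    pose proof (Ck_on_pred _ _ _ Hf0); pose proof (Ck_on_pred _ _ _ Hg0).
    destruct Hf0 as [f' [Hf Hf']], Hg0 as [g' [Hg Hg']].
    exists (fun x => f' x * g x + f x * g' x); split.
    + intros x Hx; apply Dmult; auto.
    + apply Ck_on_plus; auto.
Qed.

Lemma Ck_on_pow (k : nat) (D : R -> Prop) (f : R -> R) (n : nat) :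
  Ck_on k D f -> Ck_on k D (fun x => f x ^ n).
Proof.
  intros Hf; induction n as [| n IH]; [apply (Ck_on_const k D 1) |].
  apply (Ck_on_mult k D f (fun x => f x ^ n)); assumption.
Qed.

Lemma Ck_on_exp (k : nat) (D : R -> Prop) (f : R -> R) :
  Ck_on k D f -> Ck_on k D (fun x => exp (f x)).
Proof.
  revert f; induction k as [| k IH]; intros f Hf0.
  - intros x Hx; apply continue_in_comp; [apply Hf0, Hx |].
    apply (ex_derive_continuous exp); eexists; apply is_derive_exp.
  - pose proof (Ck_on_pred _ _ _ Hf0); destruct Hf0 as [f' [Hf Hf']].
    exists (fun x => exp (f x) * f' x); split.
    + intros x Hx; apply (D_in_comp f f' exp exp); [auto | apply is_derive_exp].
    + apply Ck_on_mult; auto.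
Qed.

(** Each differentiation lowers the exponent by one, and [INR k < q] keeps the last exponent
    positive, so zeros of [f] do no harm. *)
Lemma Ck_on_rpow (k : nat) (D : R -> Prop) (f : R -> R) (q : R) :
  INR k < q -> Ck_on k D f -> Ck_on k D (fun x => rpow (f x) q).
Proof.
  revert f q; induction k as [| k IH]; intros f q Hq Hf0.
  - intros x Hx; apply (continue_in_comp f (fun u => rpow u q)); [apply Hf0, Hx |].
    apply continuous_rpow; assumption.
  - pose proof (Ck_on_pred _ _ _ Hf0); destruct Hf0 as [f' [Hf Hf']].
    rewrite S_INR in Hq; pose proof (pos_INR k).
    exists (fun x => q * rpow (f x) (q - 1) * f' x); split.
    + intros x Hx.
      apply (D_in_comp f f' (fun u => rpow u q) (fun u => q * rpow u (q - 1))); [auto |].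
      apply is_derive_rpow; lra.
    + apply Ck_on_mult; [apply Ck_on_mult; [apply Ck_on_const | apply IH; [lra | auto]] | auto].
Qed.

(** Away from the singularity at 0 every real exponent is allowed; the exponent -1 gives
    reciprocals. *)
Lemma Ck_on_rpow_pos (k : nat) (D : R -> Prop) (f : R -> R) (q : R) :
  (forall x, D x -> 0 < f x) -> Ck_on k D f -> Ck_on k D (fun x => rpow (f x) q).
Proof.
  intros Hpos; revert q; induction k as [| k IH]; intros q Hf0.
  - intros x Hx; apply (continue_in_comp f (fun u => rpow u q)); [apply Hf0, Hx |].
    apply (ex_derive_continuous (fun u => rpow u q)); eexists.
    apply is_derive_rpow_pos; auto.
  - pose proof (Ck_on_pred _ _ _ Hf0); destruct Hf0 as [f' [Hf Hf']].
    exists (fun x => q * rpow (f x) (q - 1) * f' x); split.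
    + intros x Hx.
      apply (D_in_comp f f' (fun u => rpow u q) (fun u => q * rpow u (q - 1))); [auto |].
      apply is_derive_rpow_pos; auto.
    + apply Ck_on_mult; [apply Ck_on_mult; [apply Ck_on_const | auto] | auto].
Qed.

Lemma Ck_on_inv (k : nat) (D : R -> Prop) (f : R -> R) :
  (forall x, D x -> 0 < f x) -> Ck_on k D f -> Ck_on k D (fun x => / f x).
Proof.
  intros Hpos Hf; apply Ck_on_ext with (fun x => rpow (f x) (- (1))).
  - intros x Hx; rewrite rpow_pos_eq by auto.
    rewrite Rpower_Ropp, Rpower_1 by auto; reflexivity.
  - apply Ck_on_rpow_pos; assumption.
Qed.

Lemma Ck_on_expint (k : nat) (D : R -> Prop) : Ck_on k D expint.
Proof.
  apply Ck_on_pred; exists (fun z => exp (z ^ 2)); split.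
  - intros x _; apply is_derive_D_in, is_derive_expint.
  - apply Ck_on_exp, Ck_on_pow, Ck_on_id.
Qed.

(* Bootstrap: in [y' = r / (1 + delta * y ^ p)] the right-hand side is as smooth
   as [y ^ p], so each order of smoothness of [y] gives the next one. *)
Lemma Ck_on_ode (k : nat) (D : R -> Prop) (y r : R -> R) (delta p : R) :
  0 < delta ->
  (forall x, D x -> D_in y (fun u => r u * / (1 + delta * rpow (y u) p)) D x) ->
  Cinf_on D r ->
  (forall j, (j < k)%nat -> Ck_on j D y -> Ck_on j D (fun x => rpow (y x) p)) ->
  Ck_on k D y.
Proof.
  intros Hd Hy Hr; induction k as [| k IH]; intros Hpow.
  - intros x Hx; eapply cont_deriv, Hy, Hx.
  - exists (fun u => r u * / (1 + delta * rpow (y u) p)); split; [assumption |].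
    apply Ck_on_mult; [apply Hr |].
    apply Ck_on_inv.
    + intros x _; pose proof (Rmult_le_pos _ _ (Rlt_le _ _ Hd) (rpow_ge0 (y x) p)); lra.
    + apply Ck_on_plus; [apply Ck_on_const |].
      apply Ck_on_mult; [apply Ck_on_const |].
      apply Hpow; auto with arith.
Qed.

(** * The similarity profile *)

Lemma kirchhoff_pos_inv (delta p z : R) : 0 < kirchhoff delta p z -> 0 < z.
Proof.
  intros H; destruct (Rlt_le_dec 0 z) as [L | L]; [assumption |].
  unfold kirchhoff in H; rewrite rpow_nonpos_eq in H; lra.
Qed.

Lemma heat_capacity_pos (delta p z : R) : 0 < delta -> 0 < 1 + delta * rpow z p.
Proof.
  intros Hd; pose proof (Rmult_le_pos _ _ (Rlt_le _ _ Hd) (rpow_ge0 z p)); lra.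
Qed.

(* The derivative of the right-hand side of the equation defining [y], with [c]
   standing for [Cfun A Ste delta lam]. *)
Definition profile_flux (A delta c eta : R) : R :=
  - (c * (2 / sqrt PI * exp (- (eta ^ 2)) * (A * expint eta + 1 + delta))).

Lemma exp_sqr_cancel (x : R) : exp (- (x ^ 2)) * exp (x ^ 2) = 1.
Proof. rewrite <- exp_plus, Rplus_opp_l; apply exp_0. Qed.

(** For the profile, [- (c * (2 / sqrt PI))] is [y'(0)], so this is the reduced equation
    [F' + 2 eta F = A y'(0)] for the flux [F]. *)
Lemma is_derive_profile_flux (A delta c eta : R) :
  is_derive (profile_flux A delta c) eta
    (- (2 * eta * profile_flux A delta c eta) - A * (c * (2 / sqrt PI))).
Proof.
  unfold profile_flux; auto_derive; [eexists; apply is_derive_expint |].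
  rewrite Derive_expint.
  pose proof (exp_sqr_cancel eta) as He.
  replace (eta * (eta * 1)) with (eta ^ 2) by ring.
  replace (A * (c * (2 / sqrt PI)))
    with (A * (c * (2 / sqrt PI)) * (exp (- (eta ^ 2)) * exp (eta ^ 2)))
    by (rewrite He; ring).
  pose proof sqrt_PI_pos; field; lra.
Qed.

Lemma Ck_on_profile_flux (D : R -> Prop) (A delta c : R) : Cinf_on D (profile_flux A delta c).
Proof.
  intros k; apply Ck_on_ext with
    (fun eta => - (c * (2 / sqrt PI)) * (exp ((-1) * eta ^ 2) * (A * expint eta + (1 + delta)))).
  - intros x _; unfold profile_flux; replace (-1 * x ^ 2) with (- (x ^ 2)) by ring; ring.
  - apply Ck_on_mult; [apply Ck_on_const | apply Ck_on_mult].
    + apply Ck_on_exp, Ck_on_mult; [apply Ck_on_const | apply Ck_on_pow, Ck_on_id].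
    + apply Ck_on_plus; [| apply Ck_on_const].
      apply Ck_on_mult; [apply Ck_on_const | apply Ck_on_expint].
Qed.

(** The equation is imposed on all of the line rather than on [[0, lam]], which makes derivatives at
    0 and [lam] two-sided. *)
Definition profile_eq (A delta p c : R) (y : R -> R) : Prop :=
  forall eta, kirchhoff delta p (y eta) = 1 + delta / (p + 1) - c * Nfun A delta eta.

Lemma profile_exists (A delta p c : R) :
  0 < delta -> 0 < p -> exists y, profile_eq A delta p c y.
Proof.
  intros Hd Hp.
  exists (fun eta => proj1_sig (kirchhoff_surj delta p
    (1 + delta / (p + 1) - c * Nfun A delta eta) Hd Hp)).
  intros eta; apply proj2_sig.
Qed.

Lemma is_derive_profile (A delta p c : R) (y : R -> R) (eta : R) :
  0 < delta -> 0 < p -> profile_eq A delta p c y ->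
  is_derive y eta (profile_flux A delta c eta * / (1 + delta * rpow (y eta) p)).
Proof.
  intros Hd Hp Hy.
  set (g := fun v => proj1_sig (kirchhoff_surj delta p v Hd Hp)).
  set (r := fun u => 1 + delta / (p + 1) - c * Nfun A delta u).
  assert (Hg : forall w, kirchhoff delta p (g w) = w) by (intros w; apply proj2_sig).
  (* By injectivity [y] is the inverse transform composed with the explicit right-hand side [r], so
     the chain rule applies. *)
  assert (Hgy : forall u, g (r u) = y u).
  { intros u; apply (kirchhoff_inj delta p); [assumption | assumption |].
    rewrite Hg; symmetry; apply Hy. }
  apply is_derive_ext with (fun u => g (r u)); [exact Hgy |].
  rewrite <- Hgy.
  apply (is_derive_comp g r); [apply is_derive_kirchhoff_inv; assumption |].
  unfold r, profile_flux.
  set (m := 2 / sqrt PI * exp (- (eta ^ 2)) * (A * expint eta + 1 + delta)).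
  replace (- (c * m)) with (0 - c * m) by ring.
  apply (is_derive_minus (fun _ => 1 + delta / (p + 1)) (fun u => c * Nfun A delta u));
    [apply @is_derive_const |].
  apply is_derive_scal, is_derive_Nfun.
Qed.

Lemma profile_at_0 (A delta p c : R) (y : R -> R) :
  0 < delta -> 0 < p -> profile_eq A delta p c y -> y 0 = 1.
Proof.
  intros Hd Hp Hy; apply (kirchhoff_inj delta p); [assumption | assumption |].
  rewrite Hy, kirchhoff_1, Nfun_0; ring.
Qed.

Lemma profile_at_front (A delta p c lam : R) (y : R -> R) :
  0 < delta -> 0 < p -> profile_eq A delta p c y ->
  c * Nfun A delta lam = 1 + delta / (p + 1) -> y lam = 0.
Proof.
  intros Hd Hp Hy Hlam; apply (kirchhoff_inj delta p); [assumption | assumption |].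
  rewrite Hy, kirchhoff_0, Hlam; ring.
Qed.

(** By the front equation the transform of [y eta] equals [c * (Nfun A delta lam - Nfun A delta
    eta)], and the transform is positive only at positive arguments. *)
Lemma profile_pos (A delta p c lam : R) (y : R -> R) :
  0 < A -> 0 < delta -> 0 < p -> 0 < c -> profile_eq A delta p c y ->
  c * Nfun A delta lam = 1 + delta / (p + 1) ->
  forall eta, 0 <= eta < lam -> 0 < y eta.
Proof.
  intros HA Hd Hp Hc Hy Hlam eta Heta.
  apply (kirchhoff_pos_inv delta p); rewrite Hy.
  pose proof (Nfun_incr A delta eta lam HA Hd ltac:(lra) ltac:(lra)) as HN.
  pose proof (Rmult_lt_compat_l c _ _ Hc HN); lra.
Qed.

(** Every order [j < k] in the bootstrap satisfies [j < p], so [y ^ p] is C^j even across a zero of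
    [y]. *)
Lemma profile_Ck (A delta p c : R) (y : R -> R) (k : nat) (D : R -> Prop) :
  0 < delta -> 0 < p -> profile_eq A delta p c y -> INR k < p + 1 -> Ck_on k D y.
Proof.
  intros Hd Hp Hy Hk.
  apply Ck_on_ode with (profile_flux A delta c) delta p; [assumption | | |].
  - intros x _; apply is_derive_D_in, (is_derive_profile A); assumption.
  - apply Ck_on_profile_flux.
  - intros j Hj Hyj; apply Ck_on_rpow; [| assumption].
    apply le_INR in Hj; rewrite S_INR in Hj; lra.
Qed.

(** On [z >= 0] the power is then a monomial, so no order is lost at the front; the sign condition
    avoids the cut-off in [rpow]. *)
Lemma profile_Cinf_INR (A delta p c : R) (y : R -> R) (n : nat) (D : R -> Prop) :
  0 < delta -> 0 < p -> p = INR n -> profile_eq A delta p c y ->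
  (forall x, D x -> 0 <= y x) -> Cinf_on D y.
Proof.
  intros Hd Hp Hn Hy Hpos k.
  apply Ck_on_ode with (profile_flux A delta c) delta p; [assumption | | |].
  - intros x _; apply is_derive_D_in, (is_derive_profile A); assumption.
  - apply Ck_on_profile_flux.
  - intros j _ Hyj; apply Ck_on_ext with (fun x => y x ^ n); [| apply Ck_on_pow; assumption].
    intros x Hx; rewrite Hn, rpow_INR; [reflexivity | | auto].
    apply INR_lt; simpl; lra.
Qed.

Lemma profile_Cinf_pos (A delta p c : R) (y : R -> R) (D : R -> Prop) :
  0 < delta -> 0 < p -> profile_eq A delta p c y ->
  (forall x, D x -> 0 < y x) -> Cinf_on D y.
Proof.
  intros Hd Hp Hy Hpos k.
  apply Ck_on_ode with (profile_flux A delta c) delta p; [assumption | | |].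
  - intros x _; apply is_derive_D_in, (is_derive_profile A); assumption.
  - apply Ck_on_profile_flux.
  - intros j _ Hyj; apply Ck_on_rpow_pos; assumption.
Qed.

Lemma profile_admissible (A delta p c lam : R) (y : R -> R) :
  0 < A -> 0 < delta -> 0 < p -> 0 < c -> 0 < lam -> profile_eq A delta p c y ->
  c * Nfun A delta lam = 1 + delta / (p + 1) -> admissible_profile lam y.
Proof.
  intros HA Hd Hp Hc Hl Hy Hlam; split; [assumption |].
  pose proof (profile_pos A delta p c lam y HA Hd Hp Hc Hy Hlam) as Hpos.
  split; [split |].
  (* Order 1 is below [p + 1] for every [p > 0], so C^1 reaches the front whatever the exponent. *)
  - apply (profile_Ck A delta p c); simpl; lra || assumption.
  - apply (profile_Cinf_pos A delta p c); assumption.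
  - intros eta Heta; destruct (Rle_lt_or_eq_dec eta lam (proj2 Heta)) as [L | ->].
    + left; apply Hpos; lra.
    + right; symmetry; apply (profile_at_front A delta p c); assumption.
Qed.

(** * From the profile to a solution of the Stefan problem *)

Lemma acoef_pos (rho k0 c0 : R) : 0 < rho -> 0 < k0 -> 0 < c0 -> 0 < acoef rho k0 c0.
Proof.
  intros; apply sqrt_lt_R0, Rdiv_lt_0_compat; [| apply Rmult_lt_0_compat]; assumption.
Qed.

Lemma acoef_sqr (rho k0 c0 : R) :
  0 < rho -> 0 < k0 -> 0 < c0 -> rho * c0 * (acoef rho k0 c0 * acoef rho k0 c0) = k0.
Proof.
  intros; unfold acoef; rewrite sqrt_sqrt; [field; lra |].
  left; apply Rdiv_lt_0_compat; [| apply Rmult_lt_0_compat]; assumption.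
Qed.

Lemma thermal_coef_similarity (m0 delta p theta0 thetaf a x t : R) (y : R -> R) :
  thetaf < theta0 ->
  thermal_coef m0 delta p theta0 thetaf (similarity_temp a theta0 thetaf y x t)
  = m0 * (1 + delta * rpow (y (x / (2 * a * sqrt t))) p).
Proof.
  intros H; unfold thermal_coef, similarity_temp.
  replace (((theta0 - thetaf) * y (x / (2 * a * sqrt t)) + thetaf - thetaf) / (theta0 - thetaf))
    with (y (x / (2 * a * sqrt t))) by (field; lra).
  reflexivity.
Qed.

Lemma is_derive_similarity_x (a theta0 thetaf x t y1 : R) (y : R -> R) :
  0 < a -> 0 < t -> is_derive y (x / (2 * a * sqrt t)) y1 ->
  is_derive (fun u => similarity_temp a theta0 thetaf y u t) x
    ((theta0 - thetaf) * y1 / (2 * a * sqrt t)).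
Proof.
  intros Ha Ht Hy; pose proof (sqrt_lt_R0 t Ht) as Hq.
  unfold similarity_temp; auto_derive.
  - exists y1; exact Hy.
  - unfold Rdiv in Hy.
    replace (Derive (fun x0 => y x0) (x * / (2 * a * sqrt t))) with y1
      by (symmetry; apply is_derive_unique, Hy).
    field; lra.
Qed.

Lemma is_derive_similarity_t (a theta0 thetaf x t y1 : R) (y : R -> R) :
  0 < a -> 0 < t -> is_derive y (x / (2 * a * sqrt t)) y1 ->
  is_derive (fun tau => similarity_temp a theta0 thetaf y x tau) t
    (- ((theta0 - thetaf) * y1 * (x / (2 * a * sqrt t)) / (2 * t))).
Proof.
  intros Ha Ht Hy; pose proof (sqrt_lt_R0 t Ht) as Hq.
  pose proof (sqrt_sqrt t (Rlt_le _ _ Ht)) as Hqq.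
  unfold similarity_temp; auto_derive.
  - split; [exists y1; exact Hy |]; split; [assumption |]; split; [| exact Logic.I].
    apply Rgt_not_eq; nra.
  - unfold Rdiv in Hy.
    replace (Derive (fun x0 => y x0) (x * / (2 * a * sqrt t))) with y1
      by (symmetry; apply is_derive_unique, Hy).
    replace (2 * t) with (2 * (sqrt t * sqrt t)) by (rewrite Hqq; reflexivity).
    field; lra.
Qed.

Lemma is_derive_similarity_front (a lam t : R) :
  0 < t -> is_derive (similarity_front a lam) t (a * lam / sqrt t).
Proof.
  intros Ht; pose proof (sqrt_lt_R0 t Ht) as Hq.
  unfold similarity_front; auto_derive; [assumption | field; lra].
Qed.

Lemma profile_Stefan_solution
  (rho l k0 c0 delta p lambda0 theta0 thetaf lam : R) (y : R -> R) :
  0 < rho -> 0 < l -> 0 < k0 -> 0 < c0 -> 0 < delta -> 0 < p -> 0 < lambda0 ->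
  thetaf < theta0 -> 0 < lam ->
  let a := acoef rho k0 c0 in
  let Ste := Stefan_number l c0 theta0 thetaf in
  let A := Acoef rho k0 c0 lambda0 in
  profile_eq A delta p (Cfun A Ste delta lam) y ->
  Cfun A Ste delta lam * Nfun A delta lam = 1 + delta / (p + 1) ->
  Stefan_solution rho l k0 c0 delta p lambda0 theta0 thetaf
    (similarity_temp a theta0 thetaf y) (similarity_front a lam).
Proof.
  intros Hrho Hl Hk0 Hc0 Hd Hp Hl0 Hth Hlam a Ste A Hy Hfront.
  pose proof (acoef_pos rho k0 c0 Hrho Hk0 Hc0) as Ha; fold a in Ha.
  pose proof (acoef_sqr rho k0 c0 Hrho Hk0 Hc0) as Haa; fold a in Haa.
  assert (HA : 0 < A).
  { apply Rdiv_lt_0_compat; [lra |]; repeat apply Rmult_lt_0_compat; assumption. }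
  set (c := Cfun A Ste delta lam) in *.
  set (F := profile_flux A delta c).
  set (m := fun eta => 1 + delta * rpow (y eta) p).
  assert (Hm : forall eta, 0 < m eta) by (intros; apply heat_capacity_pos; assumption).
  assert (Hy' : forall eta, is_derive y eta (F eta * / m eta))
    by (intros eta; apply (is_derive_profile A); assumption).
  pose proof (profile_at_0 A delta p c y Hd Hp Hy) as Hy0.
  pose proof (profile_at_front A delta p c lam y Hd Hp Hy Hfront) as Hyl.
  assert (Hfs : forall t, 0 < t -> similarity_front a lam t / (2 * a * sqrt t) = lam).
  { intros t Ht; pose proof (sqrt_lt_R0 t Ht); unfold similarity_front; field; lra. }
  pose proof sqrt_PI_pos as Hpi.
  split; [unfold similarity_front; rewrite sqrt_0; ring |].
  split.
  { intros t Ht; pose proof (sqrt_lt_R0 t Ht).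
    unfold similarity_front; repeat apply Rmult_lt_0_compat; lra. }
  exists (fun x t => let eta := x / (2 * a * sqrt t) in
            (theta0 - thetaf) * (F eta * / m eta) / (2 * a * sqrt t)).
  split; [| split; [| split; [| split]]].
  - intros x t Ht _; apply is_derive_D_in.
    apply is_derive_similarity_x; [assumption | assumption | apply Hy'].
  - intros x t Ht _.
    pose proof (sqrt_lt_R0 t Ht) as Hq; pose proof (sqrt_sqrt t (Rlt_le _ _ Ht)) as Hqq.
    set (q := sqrt t) in *; set (eta := x / (2 * a * q)).
    exists (- ((theta0 - thetaf) * (F eta * / m eta) * eta / (2 * t))).
    (* In [k(theta) theta_x] the factor [m] cancels against the one in [y' = F / m], so the flux is
       a constant multiple of [F (x / (2 a q))]; this is its derivative. *)
    exists (k0 * (theta0 - thetaf) / (2 * a * q)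
            * (/ (2 * a * q) * (- (2 * eta * F eta) - A * (c * (2 / sqrt PI))))).
    split; [| split].
    + apply is_derive_similarity_t; [assumption | assumption | apply Hy'].
    + apply is_derive_ext with
        (fun u => k0 * (theta0 - thetaf) / (2 * a * q) * F (u / (2 * a * q))).
      { intros u; rewrite thermal_coef_similarity by assumption.
        cbv zeta; fold q; fold (m (u / (2 * a * q))).
        pose proof (Hm (u / (2 * a * q))).
        match goal with |- ?u = ?v => change (@eq R u v) end.
        field; lra. }
      apply is_derive_scal.
      apply (is_derive_comp F (fun u => u / (2 * a * q))); [apply is_derive_profile_flux |].
      auto_derive; [exact Logic.I | field; lra].
    + rewrite thermal_coef_similarity by assumption; cbv zeta.
      fold q; fold eta; fold (m eta).
      replace (0 / (2 * a * q)) with 0 by (field; lra).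
      (* The slope at the fixed face is [F 0 / m 0 = - (c * (2 / sqrt PI))], so the source cancels
         the constant term of [F'] and only [- 2 eta F] is left to match the time derivative. *)
      assert (Hm0 : m 0 = 1 + delta) by (unfold m; rewrite Hy0, rpow_1_l; ring).
      assert (HF0 : F 0 = - (c * (2 / sqrt PI) * (1 + delta))).
      { unfold F, profile_flux; rewrite expint_0.
        replace (- 0 ^ 2) with 0 by ring; rewrite exp_0; ring. }
      rewrite Hm0, HF0, <- Hqq, <- Haa.
      pose proof (Hm eta).
      unfold A, Acoef; fold a.
      field; lra.
  - intros t Ht; pose proof (sqrt_lt_R0 t Ht) as Hq; unfold similarity_temp.
    replace (0 / (2 * a * sqrt t)) with 0 by (field; lra).
    rewrite Hy0; ring.
  - intros t Ht; unfold similarity_temp; rewrite Hfs, Hyl by assumption; ring.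
  - intros t Ht; pose proof (sqrt_lt_R0 t Ht) as Hq.
    exists (a * lam / sqrt t); split; [apply is_derive_similarity_front; assumption |].
    cbv zeta; rewrite Hfs by assumption.
    assert (Hml : m lam = 1) by (unfold m; rewrite Hyl, rpow_nonpos_eq; lra).
    (* [Cfun] is normalized for this: its factors cancel those of the flux at [lam] and leave the
       slope that the Stefan condition requires. *)
    assert (HFl : F lam = - (2 * lam / Ste)).
    { unfold F, profile_flux, c.
      change (Cfun A Ste delta lam)
        with (sqrt PI * lam * exp (lam ^ 2) / (Ste * (A * expint lam + 1 + delta))).
      rewrite exp_Ropp.
      pose proof (exp_pos (lam ^ 2)); pose proof (denom_pos A delta lam HA Hd (Rlt_le _ _ Hlam)).
      assert (0 < Ste).
      { apply Rdiv_lt_0_compat; [apply Rmult_lt_0_compat |]; lra. }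
      field; lra. }
    rewrite Hml, HFl, <- Haa; unfold Ste, Stefan_number; field; lra.
Qed.

(** * One-sided derivatives and extension from an interval *)

Lemma single_derivative (f d e : R -> R) (a b x : R) :
  a < b -> a <= x <= b ->
  D_in f d (closed_itv a b) x -> D_in f e (closed_itv a b) x -> d x = e x.
Proof.
  intros Hab Hx Hd He; apply (single_limit _ _ _ _ _) with (2 := Hd) (3 := He).
  intros eps Heps.
  (* Uniqueness of the limit needs points of the interval near [x] and different from it: on the
     right if [x < b], on the left at [x = b]. *)
  destruct (Rlt_le_dec x b) as [L | L].
  - exists (x + Rmin (eps / 2) (b - x)).
    pose proof (Rmin_l (eps / 2) (b - x)); pose proof (Rmin_r (eps / 2) (b - x)).
    pose proof (Rmin_pos (eps / 2) (b - x) ltac:(lra) ltac:(lra)).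
    split; [split; [unfold closed_itv |]; lra |].
    unfold Rdist; rewrite Rabs_pos_eq; lra.
  - exists (x - Rmin (eps / 2) (x - a)).
    pose proof (Rmin_l (eps / 2) (x - a)); pose proof (Rmin_r (eps / 2) (x - a)).
    pose proof (Rmin_pos (eps / 2) (x - a) ltac:(lra) ltac:(lra)).
    split; [split; [unfold closed_itv |]; lra |].
    unfold Rdist; rewrite Rabs_minus_sym, Rabs_pos_eq; lra.
Qed.

Lemma D_in_interior (f d : R -> R) (a b x : R) :
  a < x < b -> D_in f d (closed_itv a b) x -> is_derive f x (d x).
Proof.
  intros Hx H; apply is_derive_Reals.
  intros eps He; destruct (H eps He) as [alp [Ha Hl]].
  assert (Hpos : 0 < Rmin alp (Rmin (x - a) (b - x)))
    by (repeat apply Rmin_pos; lra).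
  exists (mkposreal _ Hpos); simpl; intros h Hh Hhd.
  pose proof (Rmin_l alp (Rmin (x - a) (b - x))); pose proof (Rmin_r alp (Rmin (x - a) (b - x))).
  pose proof (Rmin_l (x - a) (b - x)); pose proof (Rmin_r (x - a) (b - x)).
  replace ((f (x + h) - f x) / h) with ((f (x + h) - f x) / (x + h - x))
    by (f_equal; ring).
  apply Hl; split.
  - apply Rabs_def2 in Hhd; split; [unfold closed_itv |]; lra.
  - simpl; unfold Rdist; replace (x + h - x) with h by ring; lra.
Qed.

(** Composition with this retraction extends a function from [[a, b]] by constants, keeping
    continuity everywhere and derivatives inside. *)
Definition clamp (a b x : R) : R := Rmax a (Rmin b x).

Lemma clamp_id (a b x : R) : a <= x <= b -> clamp a b x = x.
Proof. intros H; unfold clamp; rewrite Rmin_right, Rmax_right; lra. Qed.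

Lemma clamp_in (a b x : R) : a <= b -> a <= clamp a b x <= b.
Proof.
  intros H; unfold clamp; split; [apply Rmax_l |].
  apply Rmax_lub; [assumption | apply Rmin_l].
Qed.

Lemma clamp_lipschitz (a b x u : R) : Rabs (clamp a b u - clamp a b x) <= Rabs (u - x).
Proof.
  unfold clamp, Rmax, Rmin.
  repeat destruct Rle_dec; unfold Rabs; repeat destruct Rcase_abs; lra.
Qed.

Lemma continuity_clamp (f : R -> R) (a b : R) :
  a <= b -> (forall x, a <= x <= b -> continue_in f (closed_itv a b) x) ->
  forall x, continuity_pt (fun u => f (clamp a b u)) x.
Proof.
  intros Hab Hf x eps He.
  destruct (Hf _ (clamp_in a b x Hab) eps He) as [alp [Ha Hl]].
  exists alp; split; [assumption |]; intros u [_ Hu].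
  destruct (Req_dec (clamp a b x) (clamp a b u)) as [-> | Hne].
  - simpl; unfold Rdist; rewrite Rminus_diag, Rabs_R0; assumption.
  - apply Hl; split; [split; [apply clamp_in |]; assumption |].
    eapply Rle_lt_trans; [apply clamp_lipschitz | exact Hu].
Qed.

Lemma is_derive_clamp (f : R -> R) (a b x d : R) :
  a < x < b -> is_derive f x d -> is_derive (fun u => f (clamp a b u)) x d.
Proof.
  intros Hx; apply is_derive_ext_loc.
  assert (Hpos : 0 < Rmin (x - a) (b - x)) by (apply Rmin_pos; lra).
  exists (mkposreal _ Hpos); intros u Hu.
  apply ball_Rabs in Hu; simpl in Hu.
  pose proof (Rmin_l (x - a) (b - x)); pose proof (Rmin_r (x - a) (b - x)).
  apply Rabs_def2 in Hu; rewrite clamp_id; [reflexivity | lra].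
Qed.

(** * Integration of the similarity equation *)

Lemma is_derive_value (f : R -> R) (x d e : R) : is_derive f x d -> d = e -> is_derive f x e.
Proof. intros H <-; exact H. Qed.

(* With [w = (1 + delta * y ^ p) * y1], the integrating factor [exp (eta ^ 2)] gives
   [w = y1 0 * exp (- eta ^ 2) * (A * expint eta + 1 + delta)], and integrating
   once more gives [kirchhoff (y eta)]; [y1 0] is read off from the data at [lam]. *)
Lemma boundary_value_problem_integrated (A Ste delta p lam : R) (y y1 : R -> R) :
  0 < A -> 0 < Ste -> 0 < delta -> 0 < p -> 0 < lam ->
  (forall x, 0 <= x <= lam -> D_in y y1 (closed_itv 0 lam) x) ->
  (forall x, 0 <= x <= lam -> continue_in y1 (closed_itv 0 lam) x) ->
  y 0 = 1 -> y lam = 0 -> y1 lam = - (2 * lam / Ste) ->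
  (forall x, 0 < x < lam ->
     is_derive (fun u => (1 + delta * rpow (y u) p) * y1 u) x
       (A * y1 0 - 2 * x * ((1 + delta * rpow (y x) p) * y1 x))) ->
  forall eta, 0 <= eta <= lam ->
    kirchhoff delta p (y eta)
    = 1 + delta / (p + 1) - Cfun A Ste delta lam * Nfun A delta eta.
Proof.
  intros HA HS Hd Hp Hlam Hy Hy1 Hy0 Hyl Hy1l Hode.
  set (Y := fun x => y (clamp 0 lam x)).
  set (Y1 := fun x => y1 (clamp 0 lam x)).
  assert (HY : forall x, 0 <= x <= lam -> Y x = y x)
    by (intros x Hx; unfold Y; rewrite clamp_id; trivial).
  assert (HY1 : forall x, 0 <= x <= lam -> Y1 x = y1 x)
    by (intros x Hx; unfold Y1; rewrite clamp_id; trivial).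
  assert (HYc : forall x, continuity_pt Y x).
  { apply continuity_clamp; [lra |].
    intros x Hx; apply cont_deriv with y1, Hy, Hx. }
  assert (HY1c : forall x, continuity_pt Y1 x) by (apply continuity_clamp; [lra | assumption]).
  set (W := fun x => (1 + delta * rpow (Y x) p) * Y1 x).
  assert (HWc : forall x, continuity_pt W x).
  { intros x; apply continuity_pt_mult; [| apply HY1c].
    apply continuity_pt_plus; [apply continuity_pt_const; intros ? ?; reflexivity |].
    apply continuity_pt_scal, (continuity_pt_comp Y (fun u => rpow u p)); [apply HYc |].
    apply continuity_pt_filterlim, continuous_rpow; assumption. }
  assert (HW : forall x, 0 < x < lam -> is_derive W x (A * y1 0 - 2 * x * W x)).
  { intros x Hx; unfold W at 2; rewrite HY, HY1 by lra.
    apply (is_derive_clamp (fun u => (1 + delta * rpow (y u) p) * y1 u)); auto. }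
  assert (HWs : forall x, 0 <= x <= lam ->
            exp (x ^ 2) * W x = y1 0 * (A * expint x + 1 + delta)).
  { intros x Hx.
    set (Phi := fun u => exp (u ^ 2) * W u - A * y1 0 * expint u).
    assert (HPhi : Phi x = Phi 0).
    { apply is_derive_zero_eq with lam; [| | assumption].
      - intros u Hu; unfold Phi.
        pose proof (is_derive_minus _ _ _ _ _
          (is_derive_mult _ _ u _ _ (is_derive_exp_sqr u) (HW u Hu) Rmult_comm)
          (is_derive_scal _ u (A * y1 0) _ (is_derive_expint u))) as HD.
        refine (is_derive_value _ _ _ _ HD _).
        unfold minus, plus, opp, mult; simpl; ring.
      - intros u; apply continuity_pt_minus.
        + apply continuity_pt_mult; [| apply HWc].
          eapply is_derive_continuity_pt, is_derive_exp_sqr.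
        + apply continuity_pt_scal; eapply is_derive_continuity_pt, is_derive_expint. }
    unfold Phi in HPhi; rewrite expint_0 in HPhi.
    replace (0 ^ 2) with 0 in HPhi by ring; rewrite exp_0 in HPhi.
    assert (HW0 : W 0 = (1 + delta) * y1 0)
      by (unfold W; rewrite HY, HY1, Hy0, rpow_1_l by lra; ring).
    rewrite HW0 in HPhi; lra. }
  pose proof sqrt_PI_pos as Hpi.
  assert (Hc : y1 0 * (sqrt PI / 2) = - Cfun A Ste delta lam).
  { pose proof (HWs lam ltac:(lra)) as H.
    (* Here [rpow 0 p = 0] matters: since [y lam = 0], the weight is 1 and [W lam] is the prescribed
       slope. *)
    assert (HWl : W lam = - (2 * lam / Ste))
      by (unfold W; rewrite HY, HY1, Hyl, rpow_nonpos_eq, Hy1l by lra; ring).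
    rewrite HWl in H.
    pose proof (denom_pos A delta lam HA Hd (Rlt_le _ _ Hlam)) as HD.
    replace (y1 0) with (exp (lam ^ 2) * - (2 * lam / Ste) / (A * expint lam + 1 + delta))
      by (rewrite H; field; lra).
    unfold Cfun; fold (expint lam); field; lra. }
  intros eta Heta.
  (* The factor [sqrt PI / 2] undoes the [2 / sqrt PI] in the derivative of [Nfun], so [HWs] says
     that [Psi] has derivative 0. *)
  set (Psi := fun u => kirchhoff delta p (Y u) - y1 0 * (sqrt PI / 2) * Nfun A delta u).
  assert (HPsi : Psi eta = Psi 0).
  { apply is_derive_zero_eq with lam; [| | assumption].
    - intros u Hu; unfold Psi.
      assert (HYd : is_derive Y u (Y1 u)).
      { rewrite HY1 by lra; apply is_derive_clamp; [assumption |].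
        apply D_in_interior with 0 lam; [assumption | apply Hy; lra]. }
      pose proof (is_derive_minus _ _ _ _ _
        (is_derive_comp (kirchhoff delta p) Y u _ _ (is_derive_kirchhoff delta p (Y u) Hp) HYd)
        (is_derive_scal _ u (y1 0 * (sqrt PI / 2)) _ (is_derive_Nfun A delta u))) as HD.
      refine (is_derive_value _ _ _ _ HD _).
      unfold minus, plus, opp, scal; simpl; unfold mult; simpl.
      transitivity (W u - exp (- (u ^ 2)) * (y1 0 * (A * expint u + 1 + delta)));
        [unfold W; simpl; field; lra |].
      rewrite <- HWs, <- Rmult_assoc, exp_sqr_cancel by lra; ring.
    - intros u; apply continuity_pt_minus.
      + apply (continuity_pt_comp Y (kirchhoff delta p)); [apply HYc |].
        eapply is_derive_continuity_pt, is_derive_kirchhoff; assumption.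
      + apply continuity_pt_scal; eapply is_derive_continuity_pt, is_derive_Nfun. }
  unfold Psi in HPsi; rewrite Nfun_0, Hc, !HY, Hy0, kirchhoff_1 in HPsi by lra; lra.
Qed.

(** * From a similarity solution back to the functional problem *)

Lemma D_in_affine_scaling (y y1 : R -> R) (lam b T c x : R) :
  0 < b -> 0 <= x <= b * lam -> D_in y y1 (closed_itv 0 lam) (x / b) ->
  D_in (fun u => T * y (u / b) + c) (fun u => T * y1 (u / b) / b) (closed_itv 0 (b * lam)) x.
Proof.
  intros Hb Hx Hy.
  assert (Hs : D_in (fun u => u / b) (fun _ => / b) (closed_itv 0 (b * lam)) x)
    by (apply is_derive_D_in; auto_derive; [exact Logic.I | field; lra]).
  pose proof (Dcomp _ _ _ _ _ _ _ Hs Hy) as H.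
  assert (H' : D_in (fun u => y (u / b)) (fun u => / b * y1 (u / b)) (closed_itv 0 (b * lam)) x).
  { apply D_in_imp with (2 := H).
    intros u Hu; split; [assumption |].
    destruct Hu as [H0 H1]; split.
    - apply Rdiv_le_0_compat; assumption.
    - apply Rmult_le_reg_r with b; [assumption |].
      replace (u / b * b) with u by (field; lra); lra. }
  pose proof (D_in_comp _ _ (fun v => T * v + c) (fun _ => T) _ _ H'
                ltac:(auto_derive; [exact Logic.I | ring])) as H2.
  refine (D_in_ext_on _ _ _ _ _ _ _ _ _ H2); [trivial | |].
  - assumption.
  - cbv beta; field; lra.
Qed.

Lemma similarity_solution_functional_problem
  (rho l k0 c0 delta p lambda0 theta0 thetaf lam : R) (y : R -> R)
  (theta : R -> R -> R) (s : R -> R) :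
  0 < rho -> 0 < l -> 0 < k0 -> 0 < c0 -> 0 < delta -> 0 < p -> 0 < lambda0 ->
  thetaf < theta0 ->
  let a := acoef rho k0 c0 in
  let Ste := Stefan_number l c0 theta0 thetaf in
  let A := Acoef rho k0 c0 lambda0 in
  Stefan_solution rho l k0 c0 delta p lambda0 theta0 thetaf theta s ->
  admissible_profile lam y ->
  (forall t, 0 < t -> s t = similarity_front a lam t) ->
  (forall x t, 0 < t -> 0 <= x <= s t -> theta x t = similarity_temp a theta0 thetaf y x t) ->
  functional_problem A Ste delta p lam y.
Proof.
  intros Hrho Hl Hk0 Hc0 Hd Hp Hl0 Hth a Ste A.
  intros [_ [_ [thetax [Hthx [Heat [Hbc0 [Hbcs Hstef]]]]]]] Hadm Hs Htheta.
  pose proof (acoef_pos rho k0 c0 Hrho Hk0 Hc0) as Ha; fold a in Ha.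
  pose proof (acoef_sqr rho k0 c0 Hrho Hk0 Hc0) as Haa; fold a in Haa.
  assert (HA : 0 < A).
  { apply Rdiv_lt_0_compat; [lra |]; repeat apply Rmult_lt_0_compat; assumption. }
  assert (HS : 0 < Ste) by (apply Rdiv_lt_0_compat; [apply Rmult_lt_0_compat |]; lra).
  pose proof Hadm as [Hlam [[[y1 [Hy Hy1]] _] _]].
  set (T := theta0 - thetaf); assert (HT : 0 < T) by (unfold T; lra).
  set (b := 2 * a); assert (Hb : 0 < b) by (unfold b; lra).
  (* Self-similarity makes the problem at the single time [t = 1] carry all the information. *)
  assert (Hs1 : s 1 = b * lam)
    by (rewrite Hs by lra; unfold similarity_front, b; rewrite sqrt_1; ring).
  assert (Hbl : 0 < b * lam) by (apply Rmult_lt_0_compat; assumption).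
  assert (Hth1 : forall x, 0 <= x <= b * lam -> theta x 1 = T * y (x / b) + thetaf).
  { intros x Hx; rewrite Htheta by (rewrite ?Hs1; lra).
    unfold similarity_temp; rewrite sqrt_1, Rmult_1_r; reflexivity. }
  assert (Hrange : forall x, 0 <= x <= b * lam -> 0 <= x / b <= lam).
  { intros x Hx; split; [apply Rdiv_le_0_compat; lra |].
    apply Rmult_le_reg_r with b; [assumption |].
    replace (x / b * b) with x by (field; lra); lra. }
  (* [thetax] is only some derivative relative to the closed interval; uniqueness of such
     derivatives identifies it at both ends too, where the source and the Stefan condition use
     it. *)
  assert (Hthx1 : forall x, 0 <= x <= b * lam -> thetax x 1 = T * y1 (x / b) / b).
  { intros x Hx.
    pose proof (Hthx x 1 ltac:(lra) ltac:(rewrite Hs1; lra)) as H1; rewrite Hs1 in H1.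
    pose proof (D_in_affine_scaling y y1 lam b T thetaf x Hb Hx (Hy _ (Hrange x Hx))) as H2.
    apply (single_derivative (fun u => theta u 1) (fun u => thetax u 1)
             (fun u => T * y1 (u / b) / b) 0 (b * lam)); [assumption | assumption | assumption |].
    refine (D_in_ext_on _ _ _ _ _ _ _ Hx (eq_refl _) H2).
    intros u Hu; symmetry; apply Hth1; exact Hu. }
  assert (H0b : 0 / b = 0) by (field; lra).
  assert (Hbv : forall v, b * v / b = v) by (intros v; field; lra).
  assert (Hy0 : y 0 = 1).
  { pose proof (Hbc0 1 ltac:(lra)) as H; rewrite Hth1, H0b in H by lra.
    apply Rmult_eq_reg_l with T; unfold T in *; lra. }
  assert (Hyl : y lam = 0).
  { pose proof (Hbcs 1 ltac:(lra)) as H; rewrite Hs1, Hth1, Hbv in H by lra.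
    apply Rmult_eq_reg_l with T; lra. }
  assert (Hy1l : y1 lam = - (2 * lam / Ste)).
  { destruct (Hstef 1 ltac:(lra)) as [sdot [Hsd H]].
    assert (Hsdot : sdot = a * lam / sqrt 1).
    { rewrite <- (is_derive_unique _ _ _ Hsd); apply is_derive_unique.
      apply is_derive_ext_loc with (similarity_front a lam);
        [| apply is_derive_similarity_front; lra].
      exists (mkposreal 1 Rlt_0_1); intros u Hu.
      apply ball_Rabs in Hu; simpl in Hu.
      apply Rabs_def2 in Hu; symmetry; apply Hs; lra. }
    rewrite Hsdot, sqrt_1, Hs1, Hthx1, Hbv in H by lra.
    apply Rmult_eq_reg_l with (k0 * T / b);
      [| apply Rgt_not_eq, Rdiv_lt_0_compat; [apply Rmult_lt_0_compat |]; assumption].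
    replace (k0 * T / b * y1 lam) with (k0 * (T * y1 lam / b)) by (field; lra).
    rewrite H, <- Haa; unfold Ste, Stefan_number; fold T; unfold b; field; lra. }
  assert (Hode : forall x, 0 < x < lam ->
     is_derive (fun u => (1 + delta * rpow (y u) p) * y1 u) x
       (A * y1 0 - 2 * x * ((1 + delta * rpow (y x) p) * y1 x))).
  { intros x Hx.
    assert (Hbx : 0 < b * x < b * lam)
      by (split; [apply Rmult_lt_0_compat | apply Rmult_lt_compat_l]; lra).
    destruct (Heat (b * x) 1 ltac:(lra) ltac:(rewrite Hs1; lra))
      as [thetat [fluxx [Hthetat [Hflux Heq]]]].
    assert (Hval : thetat = - (T * y1 x * x / 2)).
    { rewrite <- (is_derive_unique _ _ _ Hthetat); apply is_derive_unique.
      apply is_derive_value with (- (T * y1 x * (b * x / (2 * a * sqrt 1)) / (2 * 1))).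
      - apply is_derive_ext_loc with (fun tau => similarity_temp a theta0 thetaf y (b * x) tau).
        + assert (Hc : continuity_pt (similarity_front a lam) 1)
            by (eapply is_derive_continuity_pt, is_derive_similarity_front; lra).
          (* The similarity form is available only behind the front. As [b * x] lies strictly behind
             it at time 1, continuity of the front keeps it so at nearby times, and the time
             derivative can be computed. *)
          destruct (Hc (b * lam - b * x) ltac:(lra)) as [e [He Hce]].
          assert (Hpos : 0 < Rmin e 1) by (apply Rmin_pos; lra).
          exists (mkposreal _ Hpos); intros u Hu.
          apply ball_Rabs in Hu; simpl in Hu.
          pose proof (Rmin_l e 1); pose proof (Rmin_r e 1).
          assert (Hu0 : 0 < u) by (apply Rabs_def2 in Hu; lra).
          symmetry; apply Htheta; [assumption |].
          rewrite Hs by assumption.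
          destruct (Req_dec 1 u) as [<- | Hne]; [rewrite <- Hs by lra; rewrite Hs1; lra |].
          assert (Hcu : Rabs (similarity_front a lam u - similarity_front a lam 1)
                        < b * lam - b * x).
          { apply Hce; split; [split; [exact Logic.I | assumption] |].
            exact (Rlt_le_trans _ _ _ Hu (Rmin_l e 1)). }
          rewrite <- (Hs 1), Hs1 in Hcu by lra.
          apply Rabs_def2 in Hcu; lra.
        + apply is_derive_similarity_t; [assumption | lra |].
          rewrite sqrt_1, Rmult_1_r; fold b; rewrite Hbv.
          apply (D_in_interior y y1 0 lam); [assumption | apply Hy; unfold closed_itv; lra].
      - rewrite sqrt_1, Rmult_1_r; fold b; rewrite Hbv, Rmult_1_r; reflexivity. }
    assert (Hcoef : forall m0 u, 0 <= u <= b * lam ->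
              thermal_coef m0 delta p theta0 thetaf (theta u 1)
              = m0 * (1 + delta * rpow (y (u / b)) p)).
    { intros m0 u Hu; rewrite Htheta by (rewrite ?Hs1; lra).
      rewrite thermal_coef_similarity, sqrt_1, Rmult_1_r by assumption; reflexivity. }
    rewrite Hval, Hcoef, Hbv, Hthx1, H0b, sqrt_1 in Heq by lra.
    (* [b / (k0 * T)] removes the constants of [k(theta) theta_x]; the other [b] is the chain rule
       for [x = b v]. *)
    apply is_derive_value with (b / (k0 * T) * (b * fluxx)).
    - apply is_derive_ext_loc with (fun v => b / (k0 * T) *
        (thermal_coef k0 delta p theta0 thetaf (theta (b * v) 1) * thetax (b * v) 1)).
      + assert (Hpos : 0 < Rmin x (lam - x)) by (apply Rmin_pos; lra).
        exists (mkposreal _ Hpos); intros u Hu.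
        apply ball_Rabs in Hu; simpl in Hu.
        pose proof (Rmin_l x (lam - x)); pose proof (Rmin_r x (lam - x)).
        apply Rabs_def2 in Hu.
        assert (Hbu : 0 <= b * u <= b * lam)
          by (split; [apply Rmult_le_pos | apply Rmult_le_compat_l]; lra).
        rewrite Hcoef, Hthx1 by assumption.
        rewrite Hbv.
        match goal with |- ?u = ?v => change (@eq R u v) end.
        field; lra.
      + apply is_derive_scal.
        apply (is_derive_comp
          (fun u => thermal_coef k0 delta p theta0 thetaf (theta u 1) * thetax u 1)
          (fun v => b * v)); [exact Hflux |].
        auto_derive; [exact Logic.I | ring].
    - replace fluxx with (rho * (c0 * (1 + delta * rpow (y x) p)) * - (T * y1 x * x / 2)
                          + lambda0 / 1 * (T * y1 0 / b)) by (rewrite Heq; ring).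
      rewrite <- Haa; unfold A, Acoef; fold a; unfold b; field; lra. }
  pose proof (boundary_value_problem_integrated A Ste delta p lam y y1
    HA HS Hd Hp Hlam Hy Hy1 Hy0 Hyl Hy1l Hode) as Hfun.
  split; [assumption | split; [| exact Hfun]].
  pose proof (Hfun lam ltac:(lra)) as H; rewrite Hyl, kirchhoff_0 in H; lra.
Qed.

Theorem theorem3p3
  (rho l k0 c0 delta p lambda0 theta0 thetaf : R)
  (hrho : 0 < rho) (hl : 0 < l) (hk0 : 0 < k0) (hc0 : 0 < c0)
  (hdelta : 0 < delta) (hp : 0 < p) (hlambda0 : 0 < lambda0)
  (htheta0 : 0 < theta0) (hthetaf : thetaf < theta0) :
  let a := acoef rho k0 c0 in
  let Ste := Stefan_number l c0 theta0 thetaf in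
  let A := Acoef rho k0 c0 lambda0 in
  exists (lam : R) (y : R -> R),
    (functional_problem A Ste delta p lam y /\
     (forall (lam' : R) (y' : R -> R),
        functional_problem A Ste delta p lam' y' ->
        lam' = lam /\ (forall eta, 0 <= eta <= lam -> y' eta = y eta))) /\
    ((forall k : nat, INR k < p + 1 -> Ck_on k (closed_itv 0 lam) y) /\
     ((exists n : nat, p = INR n) -> Cinf_on (closed_itv 0 lam) y)) /\
    (similarity_solution rho l k0 c0 delta p lambda0 theta0 thetaf
       (similarity_temp a theta0 thetaf y) (similarity_front a lam) /\
     (forall (theta : R -> R -> R) (s : R -> R),
        similarity_solution rho l k0 c0 delta p lambda0 theta0 thetaf theta s ->
        (forall t, 0 <= t -> s t = similarity_front a lam t) /\
        (forall x t, 0 < t -> 0 <= x <= similarity_front a lam t ->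
           theta x t = similarity_temp a theta0 thetaf y x t))).
Proof.
  intros a Ste A.
  pose proof (acoef_pos rho k0 c0 hrho hk0 hc0) as Ha; fold a in Ha.
  assert (HA : 0 < A).
  { apply Rdiv_lt_0_compat; [lra |]; repeat apply Rmult_lt_0_compat; assumption. }
  assert (HS : 0 < Ste) by (apply Rdiv_lt_0_compat; [apply Rmult_lt_0_compat |]; lra).
  assert (HK : 0 < 1 + delta / (p + 1))
    by (pose proof (Rdiv_lt_0_compat delta (p + 1) hdelta ltac:(lra)); lra).
  destruct (front_equation_solvable A Ste delta _ HA HS hdelta HK) as [lam [Hlam Hfront]].
  pose proof (Cfun_pos A Ste delta lam HA HS hdelta Hlam) as Hc.
  destruct (profile_exists A delta p (Cfun A Ste delta lam) hdelta hp) as [y Hy].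
  pose proof (profile_admissible A delta p _ lam y HA hdelta hp Hc Hlam Hy Hfront) as Hadm.
  assert (Hunique : forall lam' y', functional_problem A Ste delta p lam' y' ->
            lam' = lam /\ (forall eta, 0 <= eta <= lam -> y' eta = y eta)).
  { intros lam' y' [[Hlam' _] [Hfront' Hy']].
    (* With equal fronts the coefficient [Cfun] agrees, so both profiles have the same transform. *)
    assert (E : lam' = lam) by (apply (front_equation_inj A Ste delta); lra).
    subst lam'; split; [reflexivity |]; intros eta Heta.
    apply (kirchhoff_inj delta p); [assumption | assumption |].
    rewrite Hy; apply Hy'; assumption. }
  exists lam, y; split; [| split; [| split]].
  - split; [| exact Hunique].
    split; [assumption | split; [assumption |]]; intros eta _; apply Hy.
  - split.
    + intros k Hk; apply (profile_Ck A delta p (Cfun A Ste delta lam)); assumption.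
    + intros [n Hn]; apply (profile_Cinf_INR A delta p (Cfun A Ste delta lam) y n);
        try assumption.
      apply Hadm.
  - split; [apply profile_Stefan_solution; assumption |].
    exists lam, y; split; [assumption | split; reflexivity].
  - intros theta s [Hsol [lam' [y' [Hadm' [Hs Htheta]]]]].
    pose proof (similarity_solution_functional_problem rho l k0 c0 delta p lambda0
      theta0 thetaf lam' y' theta s hrho hl hk0 hc0 hdelta hp hlambda0 hthetaf
      Hsol Hadm' Hs Htheta) as Hfun.
    destruct (Hunique lam' y' Hfun) as [-> Hyy].
    split.
    (* The similarity form says nothing at [t = 0]; there the initial condition [s 0 = 0] is
       used. *)
    + intros t [Ht | <-]; [apply Hs; assumption |].
      rewrite (proj1 Hsol); unfold similarity_front; rewrite sqrt_0; ring.
    + intros x t Ht Hx; rewrite Htheta by (rewrite ?Hs; assumption).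
      unfold similarity_temp; fold a; rewrite Hyy; [reflexivity |].
      pose proof (sqrt_lt_R0 t Ht) as Hq; pose proof (Rmult_lt_0_compat _ _ Ha Hq).
      split; [apply Rdiv_le_0_compat; lra |].
      apply Rmult_le_reg_r with (2 * a * sqrt t); [lra |].
      replace (x / (2 * a * sqrt t) * (2 * a * sqrt t)) with x by (field; lra).
      unfold similarity_front in Hx; lra.
Qed.
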